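(* Let $D_{1/5}\subset\mathbb{R}^3$ be the fractal polyhedron $D_s$ defined in the context with $s=\frac15$. There exists a periodic, continuous function $p_{\frac{1}{5}}: \mathbb{R} \rightarrow \mathbb{R}$ with period $\log 25$ such that, as $t\downarrow 0$, \begin{align*} H_{D_{1/5}}(t)&= \frac{21}{20} - \frac{36}{5}\frac{t^{1/2}}{\sqrt{\pi}} + \frac{132}{5\pi}t -\frac{36}{5\pi\log 5}\, t \log t + 6p_{\frac{1}{5}}(\log t)\,t + O\left(t^{3/2}\left(\log(t^{-1})\right)^{3/2}\right). \end{align*}
   Context: The heat content of an open set $D\subset\mathbb{R}^3$ is $H_D(t)=\int_{D} dx \int_{D} dy\, p(x,y;t)$, where $p(x,y;t)=(4\pi t)^{-3/2}e^{-|x-y|^{2}/(4t)}$. Construction of $D_s$ ($0<s<\sqrt2-1$): Let $Q_0\subset\mathbb{R}^3$ be an open cube of side-length $1$. Attach a regular open cube $Q_{1,i}$ of side-length $s$ to the centre $c_{1,i}$, $i=1,\dots,6$, of each face of $\partial Q_0$ (outside $Q_0$, with a face of $Q_{1,i}$ lying in that face of $\partial Q_0$ and centred at $c_{1,i}$), such that all the faces are pairwise-parallel. Inductively, for $j=2,3,\dots$, attach $N(j)=6\cdot 5^{j-1}$ open cubes $Q_{j,1},\dots,Q_{j,N(j)}$ of side-length $s^j$ to the centres of the boundary faces of the cubes $Q_{j-1,1},\dots,Q_{j-1,N(j-1)}$ (the five faces of each that are not attached to a cube of the previous generation), again with pairwise-parallel faces. With $N(1)=6$, define $$D_s=\text{interior}\left\{\overline{Q_0\cup\Big[\bigcup_{j\ge1}\bigcup_{1\le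 i\le N(j)}Q_{j,i}\Big]}\right\}.$$ For $0<s<\sqrt2-1$ no cubes in the construction overlap. *)

(* Defs.v *)
From HB Require Import structures.
From mathcomp Require Import all_boot all_order all_algebra.
From mathcomp Require Import all_classical all_reals all_analysis.
Set Implicit Arguments.
Unset Strict Implicit.
Unset Printing Implicit Defensive.
Import Order.TTheory GRing.Theory Num.Theory.
Import numFieldNormedType.Exports.
Local Open Scope classical_set_scope.
Local Open Scope ring_scope.

(* Three-dimensional space is R * R * R, with the library's product topology
   and product sigma-algebra. The library's norm on products is the sup norm,
   so Euclidean distances go through [dot]. *)

Section HeatContent.
Variable R : realType.
Implicit Types (x y : R * R * R) (t : R) (D : set (R * R * R)).

Definition dot x y : R := x.1.1 * y.1.1 + x.1.2 * y.1.2 + x.2 * y.2.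

Local Notation lebesgue3 :=
  ((@lebesgue_measure R \x @lebesgue_measure R) \x @lebesgue_measure R)%E.

Definition heat_kernel x y t : R :=
  (4 * pi * t) `^ (- (3 / 2)) * expR (- (dot (x - y) (x - y) / (4 * t))).

(* The integrals take values in [0, +oo]; for t > 0 and D of finite measure
   the double integral is finite and [fine] only changes its type. *)
Definition heat_content D t : R :=
  fine (\int[lebesgue3]_(x in D)
          \int[lebesgue3]_(y in D) (heat_kernel x y t)%:E)%E.

End HeatContent.

Section FractalPolyhedron.
Variable R : realType.
Implicit Types (c : R * R * R) (a s : R) (e : 'I_3 -> R * R * R).

(* The edge directions shared by all the cubes of the construction. *)
Definition orthonormal_frame e : Prop :=
  forall i j, dot (e i) (e j) = (i == j)%:R.

Definition open_cube e c a : set (R * R * R) :=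
  [set x | forall i, `|dot (x - c) (e i)| < a / 2].

(* A face of a cube, named by its outward unit normal: [(i, true)] stands for
   [e i] and [(i, false)] for [- e i]. *)
Definition face : Type := ('I_3 * bool)%type.

Definition opposite (f : face) : face := (f.1, ~~ f.2).

Definition normal e (f : face) : R * R * R := if f.2 then e f.1 else - e f.1.

Definition face_centre e c a (f : face) : R * R * R :=
  c + (a / 2) *: normal e f.

(* Start from the cube of centre c and side-length a; at each step attach, to
   the centre of the next face of w, a cube with side-length scaled by s, and
   move to it. The result is the last cube reached. *)
Fixpoint attached_cube e s c a (w : seq face) : set (R * R * R) :=
  if w is f :: w' then
    attached_cube e s (face_centre e c a f + (s * a / 2) *: normal e f)
                  (s * a) w'
  else open_cube e c a.

(* The face of an attached cube that lies in the previous cube is [opposite f],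
   where f is the face it was attached to; nothing is attached there. Hence the
   admissible sequences of length j >= 1 are in number 6 * 5 ^ (j - 1) and index
   the cubes of generation j; [[::]] indexes the initial cube. *)
Definition admissible (w : seq face) : bool :=
  sorted (fun f g => g != opposite f) w.

(* The initial cube has side-length 1, centre c and edge directions e. *)
Definition fractal_polyhedron e c s : set (R * R * R) :=
  interior (closure (\bigcup_(w in [set w | admissible w])
                       attached_cube e s c 1 w)).

End FractalPolyhedron.

(* Main.v *)
Require Import Defs.
From HB Require Import structures.
From mathcomp Require Import all_boot all_order all_algebra.
From mathcomp Require Import all_classical all_reals all_analysis.
From mathcomp Require Import measurable_realfun ring lra.
Set Implicit Arguments.
Unset Strict Implicit.
Unset Printing Implicit Defensive.
Import Order.TTheory GRing.Theory Num.Theory.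
Import numFieldNormedType.Exports.
Local Open Scope classical_set_scope.
Local Open Scope ring_scope.

(** Write I_t(A, B) for the integral of the heat kernel at time t over A x B
   ([inter3]), S for sqrt (t / pi), and D for the fractal polyhedron of ratio
   1/5. Up to a null set, D is the disjoint union of the open cubes of the
   construction ([fractal_polyhedron_ae]), so its heat content is I_t(U, U),
   where U is this union.

   For a face f, the tower T_f is the unit cube together with all that grows on
   it when it is itself attached through f, that is on every face but
   [opposite f]. Every piece of the construction that grows on a face g of a
   unit cube Q is a copy of T_g scaled by 1/5, called a branch. So both U and
   T_f are a cube Q together with a set of branches B_g, and I_t of such a set
   splits into four kinds of terms.
   - I_t(Q, Q) is the cube of the one-dimensional quantity for the unit interval,
     which is 1 - 2 S up to O(t^2); hence it is 1 - 6 S + 12 t / pi + O(t^(3/2)).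
   - I_t(Q, B_g) comes from the square of area 1/25 through which Q and B_g touch:
     it is S / 25 + O(t^(3/2)). The rest of the branch lies at a positive
     distance from Q.
   - I_t(B_g, B_h) with g <> h is O(t^(3/2)), because a slab separates the two
     branches.
   - I_t(B_g, B_g) = I_{25 t}(T_g, T_g) / 125 by the scaling of the heat kernel.
   This is [cube_with_branches_expansion]. Summed over the six faces f, it says
   that W(t), the sum of the I_t(T_f, T_f), satisfies
     W(t) = W(25 t) / 25 + 6 - (168 / 5) S + (72 / pi) t + O(t^(3/2)),
   the factor 1/25 being 5 / 125 as each face g grows on five of the towers.

   The factor 25 in time and 1/25 in size make the function t a solution of the
   homogeneous equation. Therefore the source term (72 / pi) t produces a
   multiple of t log t, and the equation leaves undetermined exactly a term
   q (log t) t with q of period log 25. After subtraction of the explicit terms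
   and division by t, one is left with a function v of y = log t that satisfies
   v(y) = v(y + log 25) + O(e^(y/2)). Then the v(y - n log 25) converge
   geometrically, locally uniformly in y, to a continuous periodic limit q, and
   v - q = O(e^(y/2)) ([quasi_periodic_limit], [renewal]). Inserting the
   expansion of W into that of I_t(U, U), which involves W(25 t), gives the
   result, with an error O(t^(3/2)). *)

(** * Lebesgue measure on three-dimensional space *)

Section ProductSigmaFinite.
Context d1 d2 (T1 : measurableType d1) (T2 : measurableType d2) (R : realType).
Variable m1 : {sigma_finite_measure set T1 -> \bar R}.
Variable m2 : {sigma_finite_measure set T2 -> \bar R}.

Lemma product_sigma_finite : sigma_finite setT (m1 \x m2)%E.
Proof.
have [F TF Foo] := sigma_finiteT m1.
have [G TG Goo] := sigma_finiteT m2.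
pose P k := if @unpickle (nat * nat)%type k is Some ij
  then F ij.1 `*` G ij.2 else set0.
exists P.
  rewrite predeqE => -[x y]; split => // _.
  have [i _ Fix] : (\bigcup_i F i) x by rewrite -TF.
  have [j _ Gjy] : (\bigcup_j G j) y by rewrite -TG.
  by exists (pickle (i, j)) => //; rewrite /P pickleK.
move=> k; rewrite /P; case: unpickle => [[i j]/=|]; last first.
  by split; [exact: measurable0|rewrite measure0].
have [mF Fi] := Foo i; have [mG Gj] := Goo j; split; first exact: measurableX.
by rewrite product_measure1E// lte_mul_pinfty// ge0_fin_numE.
Qed.
End ProductSigmaFinite.

Section Mu3.
Variable R : realType.

(** The product measures are named so that they can carry a sigma-finite
   structure, which Fubini's theorem on pairs of points of space requires. *)
Definition mu2 := (@lebesgue_measure R \x @lebesgue_measure R)%E.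
HB.instance Definition _ := Measure.on mu2.
HB.instance Definition _ :=
  Measure_isSigmaFinite.Build _ _ _ mu2 (product_sigma_finite _ _).
Definition mu3 := (mu2 \x @lebesgue_measure R)%E.
HB.instance Definition _ := Measure.on mu3.
HB.instance Definition _ :=
  Measure_isSigmaFinite.Build _ _ _ mu3 (product_sigma_finite _ _).

End Mu3.

Section Affine1.
Variable R : realType.
Local Notation M := (measurableTypeR R).
Local Notation mu1 := (@lebesgue_measure R).

Definition affine1 (a b : R) (x : M) : M := a * x + b.

Lemma measurable_affine1 (a b : R) : measurable_fun [set: M] (affine1 a b).
Proof.
apply: measurable_funD; last exact: measurable_cst.
by apply: measurable_funM; [exact: measurable_cst|exact: measurable_id].
Qed.

(** The measure [a * mu1 (affine1 a b @^-1` A)] agrees with Lebesgue measure on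
   half-open intervals, hence everywhere. *)
Lemma lebesgue_measure_affine_gt0 (a b : R) (A : set M) : 0 < a -> measurable A ->
  mu1 (affine1 a b @^-1` A) = (a^-1%:E * mu1 A)%E.
Proof.
move=> a0 mA.
suff -> : mu1 A = (a%:E * mu1 (affine1 a b @^-1` A))%E.
  by rewrite muleA -EFinM mulVf ?gt_eqF// mul1e.
have H := @lebesgue_measure_unique R
  (mscale (NngNum (ltW a0)) (pushforward mu1 (affine1 a b))).
apply: (H (measurable_affine1 a b) _ A mA) => //.
move=> _ [[c d]] /= _ <-.
rewrite /mscale/= /pushforward.
have -> : affine1 a b @^-1` [set` `]c, d]] = [set` `](c - b) / a, (d - b) / a]].
  apply/seteqP; split => x /=; rewrite !in_itv/= ltr_pdivrMr// ler_pdivlMr// ltrBlDr lerBrDr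
    (mulrC x); by [].
rewrite !lebesgue_measure_itv/= !lte_fin ltr_pM2r ?invr_gt0// ltrD2r.
case: ifP => _; rewrite ?mule0// -!EFinD -EFinM; congr EFin.
by field; rewrite gt_eqF.
Qed.

Lemma lebesgue_measure_affine (a b : R) (A : set M) : a != 0 -> measurable A ->
  mu1 (affine1 a b @^-1` A) = (`|a|^-1%:E * mu1 A)%E.
Proof.
move=> a0 mA; have [a_gt0|a_lt0|/eqP] := ltgtP 0 a.
- by rewrite gtr0_norm// lebesgue_measure_affine_gt0.
- rewrite ltr0_norm//.
  have -> : affine1 a b @^-1` A =
      (-%R : M -> M) @^-1` (affine1 (- a) b @^-1` A).
    by apply/seteqP; split => x /=; rewrite /affine1 mulrNN.
  rewrite [LHS]lebesgue_measureN//; first by rewrite lebesgue_measure_affine_gt0 ?oppr_gt0.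
  by rewrite -[X in measurable X]setTI; exact: measurable_affine1.
- by rewrite eq_sym (negbTE a0).
Qed.

End Affine1.

Section ProductMap.
Context d1 d2 (T1 : measurableType d1) (T2 : measurableType d2) (R : realType).
Variable m1 : {sigma_finite_measure set T1 -> \bar R}.
Variable m2 : {sigma_finite_measure set T2 -> \bar R}.
Variables (f1 : T1 -> T1) (f2 : T2 -> T2) (k1 k2 : R).
Hypotheses (mf1 : measurable_fun setT f1) (mf2 : measurable_fun setT f2).
Hypotheses (k1_gt0 : 0 < k1) (k2_gt0 : 0 < k2).
Hypothesis f1E : forall A, measurable A -> m1 (f1 @^-1` A) = (k1%:E * m1 A)%E.
Hypothesis f2E : forall A, measurable A -> m2 (f2 @^-1` A) = (k2%:E * m2 A)%E.

Definition pair_map (x : T1 * T2) := (f1 x.1, f2 x.2).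

Lemma measurable_pair_map : measurable_fun setT pair_map.
Proof.
by apply: measurable_fun_pair; apply: measurableT_comp.
Qed.

(** It suffices to compare the two sides on rectangles, by uniqueness of the
   product measure. *)
Lemma product_measure_pair_map (X : set (T1 * T2)) : measurable X ->
  (m1 \x m2)%E (pair_map @^-1` X) = ((k1 * k2)%:E * (m1 \x m2) X)%E.
Proof.
move=> mX.
have k_gt0 : 0 < (k1 * k2)^-1 by rewrite invr_gt0 mulr_gt0.
suff -> : (m1 \x m2)%E X =
    ((k1 * k2)^-1%:E * (m1 \x m2)%E (pair_map @^-1` X))%E.
  by rewrite muleA -EFinM divff ?mul1e// gt_eqF// mulr_gt0.
have H := @product_measure_unique _ _ _ _ _ m1 m2
  (mscale (NngNum (ltW k_gt0)) (pushforward (m1 \x m2)%E pair_map)).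
apply: (H measurable_pair_map _ X mX) => A B mA mB.
have mfA : measurable (f1 @^-1` A).
  by rewrite -[X in measurable X]setTI; exact: mf1.
have mfB : measurable (f2 @^-1` B).
  by rewrite -[X in measurable X]setTI; exact: mf2.
transitivity ((k1 * k2)^-1%:E * (m1 \x m2) (f1 @^-1` A `*` f2 @^-1` B))%E => //.
rewrite product_measure1E//.
transitivity ((k1 * k2)^-1%:E * ((k1%:E * m1 A) * (k2%:E * m2 B)))%E.
  by congr (_ * (_ * _))%E; [exact: f1E|exact: f2E].
rewrite [X in (_ * X)%E]muleACA -(EFinM k1) [LHS]muleA -(EFinM _ (k1 * k2)).
by rewrite mulVf ?mul1e// gt_eqF// mulr_gt0.
Qed.

End ProductMap.

Section Affine3.
Variable R : realType.
Local Notation M := (measurableTypeR R).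
Local Notation V3 := (M * M * M)%type.
Local Notation mu := (@mu3 R).

Definition affine3 (a : R) (b : R * R * R) (x : V3) : V3 :=
  (a *: (x : R * R * R) + b : R * R * R).

Lemma affine3E (a : R) (b : R * R * R) : affine3 a b =
  pair_map (pair_map (affine1 a b.1.1) (affine1 a b.1.2)) (affine1 a b.2).
Proof. by apply/funext => -[[x y] z]. Qed.

Lemma measurable_affine3 a b : measurable_fun setT (affine3 a b).
Proof.
rewrite affine3E; apply: measurable_pair_map; last exact: measurable_affine1.
by apply: measurable_pair_map; exact: measurable_affine1.
Qed.

Lemma mu3_affine a b (A : set V3) : a != 0 -> measurable A ->
  mu (affine3 a b @^-1` A) = ((`|a| ^- 3)%:E * mu A)%E.
Proof.
move=> a0 mA; have k0 : 0 < `|a|^-1 by rewrite invr_gt0 normr_gt0.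
have -> : `|a| ^- 3 = `|a|^-1 * `|a|^-1 * `|a|^-1.
  by rewrite -invfM -invfM exprSr expr2.
have ma c := measurable_affine1 a c.
rewrite affine3E; apply: product_measure_pair_map => //.
- exact: measurable_pair_map.
- by rewrite mulr_gt0.
- move=> B mB; apply: product_measure_pair_map => // C mC;
    exact: lebesgue_measure_affine.
- by move=> B mB; exact: lebesgue_measure_affine.
Qed.

End Affine3.

Section ChangeOfVariables.
Context d1 d2 (T1 : measurableType d1) (T2 : measurableType d2) (R : realType).
Variables (m1 : {measure set T1 -> \bar R}) (m2 : {measure set T2 -> \bar R}).
Variables (f : T1 -> T2) (k : R).
Hypotheses (mf : measurable_fun setT f) (k_ge0 : 0 <= k).
Hypothesis fE : forall A, measurable A -> m1 (f @^-1` A) = (k%:E * m2 A)%E.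

(** Change of variables for a map that multiplies measure by a constant: dilations,
   translations and rotations are all of this kind. *)
Lemma ge0_integral_preimage (D : set T2) (g : T2 -> \bar R) :
  measurable D -> measurable_fun D g -> (forall x, D x -> (0 <= g x)%E) ->
  (\int[m1]_(x in f @^-1` D) g (f x) = k%:E * \int[m2]_(x in D) g x)%E.
Proof.
move=> mD mg g0.
rewrite -[LHS](ge0_integral_pushforward mf m1 mD mg); last first.
  by move=> y /set_mem; exact: g0.
rewrite -(ge0_integral_mscale m2 mD (NngNum k_ge0) mg g0).
apply: (@eq_measure_integral _ _ _ _ (mscale (NngNum k_ge0) m2)
  (pushforward m1 f : {measure set _ -> \bar R})) => //.
by move=> A mA _; exact: fE.
Qed.
End ChangeOfVariables.

(** * Coordinates in an orthonormal frame *)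

Section Coordinates.
Variable R : realType.
Local Notation M := (measurableTypeR R).
Local Notation V3 := (M * M * M)%type.
Implicit Types (x y z : R * R * R) (e : 'I_3 -> R * R * R).

Lemma measurable_fun_V3 d (T : measurableType d) (f : T -> V3) :
  measurable_fun setT (fun t => (f t).1.1) ->
  measurable_fun setT (fun t => (f t).1.2) ->
  measurable_fun setT (fun t => (f t).2) -> measurable_fun setT f.
Proof.
move=> f1 f2 f3.
rewrite (_ : f = fun t => ((f t).1.1, (f t).1.2, (f t).2)); last first.
  by apply/funext => t; case: (f t) => [[]].
by apply: measurable_fun_pair => //; exact: measurable_fun_pair.
Qed.

Lemma measurable_co1 : measurable_fun setT (fun x : V3 => x.1.1).
Proof. by apply: measurableT_comp. Qed.
Lemma measurable_co2 : measurable_fun setT (fun x : V3 => x.1.2).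
Proof. by apply: measurableT_comp. Qed.
Lemma measurable_co3 : measurable_fun setT (fun x : V3 => x.2).
Proof. exact: measurable_snd. Qed.

Lemma dotC x y : dot x y = dot y x.
Proof. by rewrite /dot; ring. Qed.
Lemma dotDl x y z : dot (x + y) z = dot x z + dot y z.
Proof. by rewrite /dot /=; ring. Qed.
Lemma dotNl x z : dot (- x) z = - dot x z.
Proof. by rewrite /dot /=; ring. Qed.
Lemma dotBl x y z : dot (x - y) z = dot x z - dot y z.
Proof. by rewrite dotDl dotNl. Qed.
Lemma dotZl (k : R) x z : dot (k *: x) z = k * dot x z.
Proof. by rewrite /dot /= /GRing.scale /=; ring. Qed.

Lemma measurable_dot d (T : measurableType d) (f g : T -> V3) :
  measurable_fun setT f -> measurable_fun setT g ->
  measurable_fun setT (fun t => dot (f t) (g t) : M).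
Proof.
move=> mf mg.
have m1 := measurableT_comp measurable_co1; have m2 := measurableT_comp measurable_co2.
have m3 := measurableT_comp measurable_co3.
apply: measurable_funD; last first.
  by apply: measurable_funM; apply: m3.
by apply: measurable_funD; apply: measurable_funM; (exact: m1 || exact: m2).
Qed.

Definition i0 : 'I_3 := @Ordinal 3 0 isT.
Definition i1 : 'I_3 := @Ordinal 3 1 isT.
Definition i2 : 'I_3 := @Ordinal 3 2 isT.

Lemma ord3P (P : 'I_3 -> Prop) : P i0 -> P i1 -> P i2 -> forall i, P i.
Proof.
by move=> P0 P1 P2 [[|[|[|//]]] lti]; [move: P0|move: P1|move: P2];
  congr (P _); exact: val_inj.
Qed.

Lemma sum_ord3 (F : 'I_3 -> R) : \sum_(i < 3) F i = F i0 + F i1 + F i2.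
Proof.
rewrite !big_ord_recl big_ord0 addr0 addrA.
by congr (F _ + F _ + F _); exact: val_inj.
Qed.

Definition frame_coords e (x : R * R * R) : R * R * R :=
  (dot x (e i0), dot x (e i1), dot x (e i2)).

Lemma measurable_frame_coords e :
  measurable_fun setT (frame_coords e : V3 -> V3).
Proof.
by apply: measurable_fun_V3;
  apply: measurable_dot; (exact: measurable_id || exact: measurable_cst).
Qed.

Lemma frame_coordsD e x y :
  frame_coords e (x + y) = frame_coords e x + frame_coords e y.
Proof. by rewrite /frame_coords !dotDl. Qed.

Lemma frame_coordsB e x y :
  frame_coords e (x - y) = frame_coords e x - frame_coords e y.
Proof. by rewrite /frame_coords !dotBl. Qed.

Lemma frame_coords_surj e : orthonormal_frame e ->
  forall z, exists x, frame_coords e x = z.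
Proof.
move=> oe [[a b] c]; exists (a *: e i0 + b *: e i1 + c *: e i2).
rewrite /frame_coords !dotDl !dotZl !oe /= !mulr0 !mulr1.
by rewrite !addr0 !add0r.
Qed.

(** Parseval's identity. The matrix E with rows [e i] satisfies E E^T = 1, hence
   also E^T E = 1, and the entries of the latter are the coefficients of the
   monomials in the expansion of the left-hand side. *)
Lemma dot_frame_coords e x y : orthonormal_frame e ->
  dot (frame_coords e x) (frame_coords e y) = dot x y.
Proof.
move=> oe.
pose E : 'M[R]_3 := \matrix_(i, j)
  (if j == i0 then (e i).1.1 else if j == i1 then (e i).1.2 else (e i).2).
have EE : E *m E^T = 1%:M.
  apply/matrixP => i j; rewrite !mxE sum_ord3 !mxE /=.
  by have := oe i j; rewrite /dot.
have {}EE : E^T *m E = 1%:M by apply: mulmx1C.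
have key (a b : 'I_3) : E i0 a * E i0 b + E i1 a * E i1 b + E i2 a * E i2 b = (a == b)%:R.
  have /matrixP/(_ a b) := EE; rewrite !mxE sum_ord3 => <-.
  by rewrite [in RHS]/trmx !mxE.
have := (key i0 i0, key i0 i1, key i0 i2, key i1 i1, key i1 i2, key i2 i2).
rewrite !mxE /= => -[[[[[]]]]].
rewrite /dot /=.
case: x y => [[x1 x2] x3] [[y1 y2] y3] /=.
move: (e i0) (e i1) (e i2) => [[a1 a2] a3] [[b1 b2] b3] [[c1 c2] c3] /=.
move=> k00 k01 k02 k11 k12 k22; rewrite /dot /=.
transitivity (x1 * y1 * (a1 * a1 + b1 * b1 + c1 * c1)
  + (x1 * y2 + x2 * y1) * (a1 * a2 + b1 * b2 + c1 * c2)
  + (x1 * y3 + x3 * y1) * (a1 * a3 + b1 * b3 + c1 * c3)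
  + x2 * y2 * (a2 * a2 + b2 * b2 + c2 * c2)
  + (x2 * y3 + x3 * y2) * (a2 * a3 + b2 * b3 + c2 * c3)
  + x3 * y3 * (a3 * a3 + b3 * b3 + c3 * c3)); first by ring.
by rewrite k00 k01 k02 k11 k12 k22; ring.
Qed.

End Coordinates.

Section Rotation.
Variable R : realType.
Local Notation M := (measurableTypeR R).
Local Notation V3 := (M * M * M)%type.
Local Notation mu := (@mu3 R).

Lemma mu3_box (I J K : set M) : measurable I -> measurable J -> measurable K ->
  mu (I `*` J `*` K) =
  (lebesgue_measure I * lebesgue_measure J * lebesgue_measure K)%E.
Proof.
move=> mI mJ mK.
rewrite [LHS](@product_measure1E _ _ _ _ _ (@mu2 R) (@lebesgue_measure R))//.
  by congr (_ * _)%E; rewrite [LHS]product_measure1E.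
exact: measurableX.
Qed.

Lemma ge0_integral_affine3 a b (g : V3 -> \bar R) : a != 0 ->
  measurable_fun setT g -> (forall x, (0 <= g x)%E) ->
  (\int[mu]_x g (affine3 a b x) = (`|a| ^- 3)%:E * \int[mu]_x g x)%E.
Proof.
move=> a0 mg g0.
rewrite -(@ge0_integral_preimage _ _ _ _ _ mu mu (affine3 a b))//.
- exact: measurable_affine3.
- by move=> A mA; exact: mu3_affine.
Qed.

Section Haar.
Variable f : V3 -> V3.
Hypothesis mf : measurable_fun setT f.
Hypothesis fD : forall x y : R * R * R, f (x + y : R * R * R) =
  (f x : R * R * R) + f y :> R * R * R.
Hypothesis f_surj : forall z, exists x, f x = z.

(** An additive surjection transports Lebesgue measure to a multiple of itself;
   this is the usual uniqueness proof for translation-invariant measures. The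
   left-hand side is the integral of [1_E (f x) * 1_B (y + f x)] over x and y, by
   translation in y. At fixed y, translating x by some b with [f b = - y] turns
   the integrand into [1_E (f x - y) * 1_B (f x)], whose integral is the
   right-hand side by translation and reflection in y. *)
Lemma pushforward_linear_proportional (E B : set V3) :
  measurable E -> measurable B ->
  (mu (f @^-1` E) * mu B = mu (f @^-1` B) * mu E)%E.
Proof.
move=> mE mB.
have mfE : measurable (f @^-1` E).
  by rewrite -[X in measurable X]setTI; exact: mf.
have mfB : measurable (f @^-1` B).
  by rewrite -[X in measurable X]setTI; exact: mf.
have ind_meas (A : set V3) : measurable A ->
    measurable_fun setT (fun x => (\1_A x)%:E : \bar R).
  by move=> mA; apply/measurable_EFinP; exact: measurable_indic.
have ind_int (A : set V3) : measurable A -> (\int[mu]_x (\1_A x)%:E = mu A)%E.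
  by move=> mA; rewrite integral_indic// setIT.
have add_meas (g h : V3 * V3 -> V3) : measurable_fun setT g -> measurable_fun setT h ->
    forall s : R, measurable_fun setT (fun z => affine3 s (h z) (g z)).
  move=> mg mh s.
  have key (c : V3 -> M) : measurable_fun setT c ->
      measurable_fun setT ((fun z => s * c (g z)) \+ (c \o h)).
    move=> mc; apply: measurable_funD; last exact: measurableT_comp.
    by apply: measurable_funM => //; exact: measurableT_comp.
  apply: measurable_fun_V3.
  - exact (key _ (@measurable_co1 R)).
  - exact (key _ (@measurable_co2 R)).
  - exact (key _ (@measurable_co3 R)).
pose h A C s (z : V3 * V3) : \bar R :=
  ((\1_A (f z.1))%:E * (\1_C (affine3 s (f z.1) z.2))%:E)%E.
have h0 A C s z : (0 <= h A C s z)%E by rewrite mule_ge0// lee_fin.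
have mh A C s : measurable A -> measurable C -> measurable_fun setT (h A C s).
  move=> mA mC; apply: emeasurable_funM.
    by apply: measurableT_comp (ind_meas _ mA) _; exact: measurableT_comp.
  apply: measurableT_comp (ind_meas _ mC) _; apply: add_meas => //.
  exact: measurableT_comp.
have step A C s : measurable A -> measurable C -> s != 0 -> `|s| = 1 ->
    (\int[mu]_x \int[mu]_y h A C s (x, y) = mu (f @^-1` A) * mu C)%E.
  move=> mA mC s0 s1.
  have mfA : measurable (f @^-1` A).
    by rewrite -[X in measurable X]setTI; exact: mf.
  transitivity (\int[mu]_x ((\1_(f @^-1` A) x)%:E * mu C))%E.
    apply: eq_integral => x _; rewrite /h /= ge0_integralZl//; last first.
      by apply: measurableT_comp (ind_meas _ mC) _; exact: measurable_affine3.
    congr (_ * _)%E.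
    rewrite (@ge0_integral_affine3 s (f x) (fun y => (\1_C y)%:E))//.
    + by rewrite s1 expr1n invr1 mul1e ind_int.
    + exact: ind_meas.
  by rewrite ge0_integralZr ?ind_int//; exact: ind_meas.
have m1 : - 1 != 0 :> R by rewrite oppr_eq0 oner_neq0.
have n1 : `|- 1 : R| = 1 by rewrite normrN1.
apply: (etrans (esym (step E B 1 mE mB (oner_neq0 _) (normr1 _)))).
apply: (etrans _ (step B E (-1) mB mE m1 n1)).
apply: (etrans (fubini_tonelli (h E B 1) (mh E B 1 mE mB) (h0 E B 1))).
apply: (etrans _ (esym (fubini_tonelli (h B E (-1)) (mh B E (-1) mB mE) (h0 B E (-1))))).
apply: eq_integral => y _.
have [b fb] := f_surj (- (y : R * R * R)).
have -> : (\int[mu]_x h E B 1%R (x, y) = \int[mu]_x h E B 1%R (affine3 1%R b x, y))%E.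
  rewrite (@ge0_integral_affine3 1 b (fun x => h E B 1 (x, y)))//
    ?normr1 ?expr1n ?invr1 ?mul1e//.
  exact: (measurable_fun_pair1 y (mh E B 1 mE mB)).
apply: eq_integral => x _; rewrite /h /= muleC.
have -> : f (affine3 1 b x) = affine3 (-1) (f x) y.
  by rewrite /affine3 scale1r fD fb scaleN1r addrC.
congr ((\1_B _)%:E * _)%E.
by rewrite /affine3 scale1r scaleN1r addrA subrr add0r.
Qed.

End Haar.
End Rotation.

Section RotationInvariance.
Variable R : realType.
Local Notation M := (measurableTypeR R).
Local Notation V3 := (M * M * M)%type.
Local Notation mu := (@mu3 R).

Let unit_ball : set V3 := [set x | dot x x < 1].

Let measurable_unit_ball : measurable unit_ball.
Proof.
have md : measurable_fun setT (fun x : V3 => dot x x : M).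
  by apply: measurable_dot; exact: measurable_id.
rewrite (_ : unit_ball =
    (fun x : V3 => dot x x : M) @^-1` [set` `]-oo, (1 : R)[]); last first.
  by apply/seteqP; split => x /=; rewrite /unit_ball/= in_itv.
by rewrite -[X in measurable X]setTI; apply: md => //; exact: measurable_itv.
Qed.

Let unit_ball_pos_fin : exists2 b : R, 0 < b & mu unit_ball = b%:E.
Proof.
have m_itv (I : interval R) : measurable ([set` I] : set M) by exact: measurable_itv.
pose I : set M := [set` `](-2^-1 : R), 2^-1[].
pose J : set M := [set` `](-1 : R), 1[].
have mI3 : measurable (I `*` I `*` I) by do 2?apply: measurableX; exact: m_itv.
have mJ3 : measurable (J `*` J `*` J) by do 2?apply: measurableX; exact: m_itv.
have lo : (mu (I `*` I `*` I) <= mu unit_ball)%E.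
  apply: le_measure; rewrite ?inE//.
  move=> [[x y] z] [[/=]]; rewrite /I /unit_ball /dot /= !in_itv /=.
  by move=> /andP[? ?] /andP[? ?] /andP[? ?]; nra.
have hi : (mu unit_ball <= mu (J `*` J `*` J))%E.
  apply: le_measure; rewrite ?inE//.
  move=> [[x y] z]; rewrite /J /unit_ball /dot /= => h.
  by split; [split|] => /=; rewrite in_itv /=; apply/andP; split; nra.
have fin : mu unit_ball \is a fin_num.
  rewrite ge0_fin_numE//; apply: le_lt_trans hi _.
  rewrite mu3_box; try exact: m_itv.
  rewrite /J lebesgue_measure_itv/= lte_fin; case: ifP => _;
    by rewrite ?mule0 // -!EFinD -!EFinM ltry.
exists (fine (mu unit_ball)); last by rewrite fineK.
rewrite -lte_fin fineK//; apply: lt_le_trans lo.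
rewrite mu3_box; try exact: m_itv.
rewrite /I lebesgue_measure_itv/= lte_fin.
have -> : - 2^-1 < 2^-1 :> R by lra.
by rewrite -!EFinD -!EFinM lte_fin; apply: mulr_gt0; [apply: mulr_gt0|]; lra.
Qed.

(** The factor by which [frame_coords e] multiplies measure is 1, because the unit
   ball is its own preimage and has positive finite measure. *)
Lemma mu3_frame_coords (e : 'I_3 -> R * R * R) (A : set V3) :
  orthonormal_frame e -> measurable A ->
  mu (frame_coords e @^-1` A) = mu A.
Proof.
move=> oe mA; have [b b0 bE] := unit_ball_pos_fin.
have := pushforward_linear_proportional (measurable_frame_coords e)
  (frame_coordsD e) (frame_coords_surj oe) mA measurable_unit_ball.
have -> : frame_coords e @^-1` unit_ball = unit_ball.
  by apply/seteqP; split => x; rewrite /unit_ball/= dot_frame_coords.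
rewrite bE muleC => /(congr1 (fun x => b^-1%:E * x)%E).
by rewrite !muleA -!EFinM mulVf ?gt_eqF// !mul1e.
Qed.

(** Relates the product topology to the product sigma-algebra: U is the union of
   the countably many rational boxes that it contains. *)
Lemma open_measurable3 (U : set (R * R * R)) : open U -> measurable (U : set V3).
Proof.
move=> oU.
pose box (q : rat * rat * rat) (k : nat) : set V3 :=
  ball (ratr q.1.1 : R) k.+1%:R^-1 `*` ball (ratr q.1.2 : R) k.+1%:R^-1
    `*` ball (ratr q.2 : R) k.+1%:R^-1.
have mbox q k : measurable (box q k).
  by do 2?apply: measurableX; exact: measurable_ball.
have -> : U = \bigcup_(i in [set i : (rat * rat * rat) * nat | box i.1 i.2 `<=` U])
    box i.1 i.2.
  apply/seteqP; split; last by move=> x [i /= iU]; exact: iU.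
  move=> [[x y] z] Ux.
  have /nbhs_ballP[r /= r0 rU] : nbhs ((x, y, z) : R * R * R) U by exact: open_nbhs_nbhs.
  have [k kr] : exists k : nat, k.+1%:R^-1 < r / 2.
    have r2 : 0 < r / 2 by rewrite divr_gt0.
    exists (Num.truncn (r / 2)^-1); rewrite invf_plt ?posrE//.
    exact: truncnS_gt.
  have k0 : 0 < k.+1%:R^-1 :> R by rewrite invr_gt0 ltr0n.
  move: k0 kr; pose d : R := k.+1%:R^-1; rewrite -/d => k0 kr.
  have ratx (a : R) : exists q, ball (ratr q : R) d a.
    have /rat_in_itvoo[q] : a - d < a + d by clearbody d; lra.
    rewrite in_itv /= => /andP[? ?]; exists q.
    rewrite /ball /= ltr_norml; apply/andP; split; clearbody d; lra.
  have [qx hx] := ratx x; have [qy hy] := ratx y; have [qz hz] := ratx z.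
  exists (qx, qy, qz, k); last by [].
  move=> [[x' y'] z'] [[/= hx' hy'] hz']; apply: rU.
  have tri a b q : ball (ratr q : R) d a -> ball (ratr q : R) d b -> ball (a : R) r b.
    by rewrite /ball /= !ltr_norml => /andP[? ?] /andP[? ?];
      apply/andP; split; clearbody d; lra.
  by split; [split|]; [exact: tri hx hx'|exact: tri hy hy'|exact: tri hz hz'].
rewrite bigcup_mkcond; apply: countable_bigcupT_measurable.
  exact: countableP.
by move=> i; case: ifP => _; [exact: mbox|exact: measurable0].
Qed.

End RotationInvariance.

(** * The heat exchanged between two sets *)

Section IteratedIntegral.
Local Open Scope ereal_scope.
Context d1 d2 (T1 : measurableType d1) (T2 : measurableType d2) (R : realType).
Variable m1 : {sigma_finite_measure set T1 -> \bar R}.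
Variable m2 : {sigma_finite_measure set T2 -> \bar R}.

Lemma ge0_integral_setX (A : set T1) (B : set T2) (f : T1 * T2 -> \bar R) :
  measurable A -> measurable B -> measurable_fun setT f ->
  (forall z, 0 <= f z) ->
  \int[m1 \x m2]_(z in A `*` B) f z = \int[m1]_(x in A) \int[m2]_(y in B) f (x, y).
Proof.
move=> mA mB mf f0.
rewrite integral_mkcond fubini_tonelli1; last 2 first.
- by apply/(measurable_restrictT _ (measurableX mA mB)); exact: measurable_funTS.
- by move=> z; rewrite patchE; case: ifP.
rewrite [RHS]integral_mkcond; apply: eq_integral => x _.
rewrite /fubini_F patchE; case: ifPn => xA.
  rewrite [RHS]integral_mkcond; apply: eq_integral => y _.
  by rewrite !patchE in_setX xA.
apply: integral0_eq => y _.
by rewrite patchE in_setX (negbTE xA).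
Qed.

Lemma ge0_integral_setX_prod (A : set T1) (B : set T2) (f : T1 -> \bar R)
    (g : T2 -> \bar R) :
  measurable A -> measurable B -> measurable_fun setT f -> measurable_fun setT g ->
  (forall x, 0 <= f x) -> (forall y, 0 <= g y) ->
  \int[m1 \x m2]_(z in A `*` B) (f z.1 * g z.2) =
  \int[m1]_(x in A) f x * \int[m2]_(y in B) g y.
Proof.
move=> mA mB mf mg f0 g0.
rewrite (@ge0_integral_setX A B (fun z => f z.1 * g z.2))//; last 2 first.
- apply: emeasurable_funM; exact: measurableT_comp.
- by move=> z; rewrite mule_ge0.
transitivity (\int[m1]_(x in A) (f x * \int[m2]_(y in B) g y)).
  apply: eq_integral => x _; rewrite /= ge0_integralZl//; exact: measurable_funTS.
rewrite ge0_integralZr//; first exact: measurable_funTS.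
exact: integral_ge0.
Qed.

End IteratedIntegral.

Section Interaction.
Context d (T : measurableType d) (R : realType).
Variable m : {sigma_finite_measure set T -> \bar R}.
Implicit Types (K : T * T -> R) (A B : set T).
Local Notation mm := (m \x m)%E.

Definition fin_meas A := measurable A /\ (m A < +oo)%E.
Definition bounded_kernel K := measurable_fun setT K /\
  exists C, forall z, 0 <= K z <= C.

Definition interaction K A B : R := \int[mm]_(z in A `*` B) K z.

Lemma bounded_kernel_ge0 K z : bounded_kernel K -> 0 <= K z.
Proof. by move=> [_ [C /(_ z)/andP[]]]. Qed.

Lemma fin_measU A B : fin_meas A -> fin_meas B -> fin_meas (A `|` B).
Proof.
move=> [mA fA] [mB fB]; split; first exact: measurableU.
by rewrite (le_lt_trans (measureU2 _ mA mB))// lte_add_pinfty.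
Qed.

Lemma fin_meas_setX A B : fin_meas A -> fin_meas B ->
  measurable (A `*` B) /\ (mm (A `*` B) = m A * m B)%E /\ (mm (A `*` B) < +oo)%E.
Proof.
move=> [mA fA] [mB fB]; have E := product_measure1E m m mA mB.
split; first exact: measurableX.
by split; rewrite ?E // lte_mul_pinfty// ge0_fin_numE.
Qed.

Lemma interaction_integrable K A B : bounded_kernel K -> fin_meas A -> fin_meas B ->
  mm.-integrable (A `*` B) (EFin \o K).
Proof.
move=> [mK [C KC]] fA fB; have [mAB [_ fAB]] := fin_meas_setX fA fB.
apply: measurable_bounded_integrable => //; first exact: measurable_funTS.
exists C; split; first exact: num_real.
move=> x Cx z _ /=; have /andP[k0 kC] := KC z.
by rewrite ger0_norm// (le_trans kC)// ltW.
Qed.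

Lemma interactionE K A B : bounded_kernel K -> measurable A -> measurable B ->
  interaction K A B = fine (\int[m]_(x in A) \int[m]_(y in B) (K (x, y))%:E)%E.
Proof.
move=> gK mA mB; rewrite /interaction /Rintegral; congr fine.
rewrite (@ge0_integral_setX _ _ _ _ _ m m A B (fun z => (K z)%:E))//.
- by apply/measurable_EFinP; case: gK.
- by move=> z; rewrite lee_fin bounded_kernel_ge0.
Qed.

Lemma interaction_ge0 K A B : bounded_kernel K -> 0 <= interaction K A B.
Proof. by move=> gK; apply: Rintegral_ge0 => z _; exact: bounded_kernel_ge0. Qed.

Lemma interaction_sym K A B : bounded_kernel K -> (forall x y, K (x, y) = K (y, x)) ->
  measurable A -> measurable B -> interaction K A B = interaction K B A.
Proof.
move=> gK Ks mA mB; rewrite !interactionE//; congr fine.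
have mK : measurable_fun setT (fun z => (K z)%:E : \bar R).
  by apply/measurable_EFinP; case: gK.
have K0 z : (0 <= (K z)%:E)%E by rewrite lee_fin bounded_kernel_ge0.
have E (D D' : set T) : measurable D -> measurable D' ->
    (\int[m]_(x in D) \int[m]_(y in D') (K (x, y))%:E
    = \int[m]_x \int[m]_y ((fun z => (K z)%:E) \_ (D `*` D')) (x, y))%E.
  move=> mD mD'.
  rewrite -(@ge0_integral_setX _ _ _ _ _ m m D D' (fun z => (K z)%:E))//.
  rewrite integral_mkcond fubini_tonelli1//.
  - by apply/(measurable_restrictT _ (measurableX mD mD')); exact: measurable_funTS.
  - by move=> z; rewrite patchE; case: ifP.
rewrite !E// fubini_tonelli; last 2 first.
- by apply/(measurable_restrictT _ (measurableX mA mB)); exact: measurable_funTS.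
- by move=> z; rewrite patchE; case: ifP.
apply: eq_integral => x _; apply: eq_integral => y _.
by rewrite !patchE !in_setX andbC Ks.
Qed.

Lemma interactionUl K A1 A2 B : bounded_kernel K ->
  fin_meas A1 -> fin_meas A2 -> fin_meas B -> A1 `&` A2 = set0 ->
  interaction K (A1 `|` A2) B = interaction K A1 B + interaction K A2 B.
Proof.
move=> gK f1 f2 fB dA; rewrite /interaction.
have -> : (A1 `|` A2) `*` B = (A1 `*` B) `|` (A2 `*` B).
  apply/seteqP; split => -[x y] /=; first by move=> [[]]; [left|right].
  by move=> [[]|[]] ? ?; split => //; [left|right].
have [m1 _] := fin_meas_setX f1 fB; have [m2 _] := fin_meas_setX f2 fB.
apply: Rintegral_setU => //.
  have -> : A1 `*` B `|` A2 `*` B = (A1 `|` A2) `*` B.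
    apply/seteqP; split => -[x y] /=; last by move=> [[]]; [left|right].
    by move=> [[]|[]] ? ?; split => //; [left|right].
  by apply: interaction_integrable => //; exact: fin_measU.
apply/disj_setPRL => -[x y] /= [x2 _] [x1 _].
by have : (A1 `&` A2) x by []; rewrite dA.
Qed.

Lemma interaction_le K (C : R) A B : bounded_kernel K -> fin_meas A -> fin_meas B ->
  (forall x y, A x -> B y -> K (x, y) <= C) ->
  interaction K A B <= C * (fine (m A) * fine (m B)).
Proof.
move=> gK fA fB KC; have [mAB [E fAB]] := fin_meas_setX fA fB.
have -> : fine (m A) * fine (m B) = fine (mm (A `*` B)).
  by rewrite E fineM// ge0_fin_numE//; [case: fA|case: fB].
rewrite -(Rintegral_cst mm mAB); apply: le_Rintegral => //.
- exact: interaction_integrable.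
- apply: measurable_bounded_integrable => //; exists `|C|; split => // x Cx z _ /=.
  exact: ltW.
- by move=> [x y] [/= Ax By]; exact: KC.
Qed.

Lemma interaction_dist K K' (C : R) A B : bounded_kernel K -> bounded_kernel K' ->
  fin_meas A -> fin_meas B ->
  (forall x y, A x -> B y -> `|K (x, y) - K' (x, y)| <= C) ->
  `|interaction K A B - interaction K' A B| <= C * (fine (m A) * fine (m B)).
Proof.
move=> gK gK' fA fB KC; have [mAB [E fAB]] := fin_meas_setX fA fB.
have iK := interaction_integrable gK fA fB.
have iK' := interaction_integrable gK' fA fB.
have iB : mm.-integrable (A `*` B) (EFin \o (fun z => K z - K' z)).
  by have := integrableB mAB iK iK'; apply: eq_integrable.
rewrite /interaction -RintegralB//.
apply: le_trans (le_normr_Rintegral mAB iB) _.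
have -> : fine (m A) * fine (m B) = fine (mm (A `*` B)).
  by rewrite E fineM// ge0_fin_numE//; [case: fA|case: fB].
rewrite -(Rintegral_cst mm mAB); apply: le_Rintegral => //.
- by have := integrable_norm iB; apply: eq_integrable.
- apply: measurable_bounded_integrable => //; exists `|C|; split => // x Cx z _ /=.
  exact: ltW.
- by move=> [x y] [/= Ax By]; exact: KC.
Qed.

End Interaction.

Section InteractionTransport.
Context d (T : measurableType d) (R : realType).
Variable m : {sigma_finite_measure set T -> \bar R}.
Variables (f : T -> T) (k : R).
Hypotheses (mf : measurable_fun setT f) (k_gt0 : 0 < k).
Hypothesis fE : forall A, measurable A -> m (f @^-1` A) = (k%:E * m A)%E.

(** The constant [c] is there for kernels that f does not leave invariant, as a
   dilation multiplies the heat kernel and changes its time. *)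
Lemma interaction_preimage (K K' : T * T -> R) (c : R) (A B : set T) :
  bounded_kernel K' -> fin_meas m A -> fin_meas m B ->
  (forall x y, K (x, y) = c * K' (f x, f y)) ->
  interaction m K (f @^-1` A) (f @^-1` B) = c * (k * k) * interaction m K' A B.
Proof.
move=> gK' fA fB KE.
have [mAB [_ fAB]] := fin_meas_setX fA fB.
have iK' := interaction_integrable gK' fA fB.
have mff := measurable_pair_map mf mf.
have ffE X : measurable X ->
    (m \x m)%E (pair_map f f @^-1` X) = ((k * k)%:E * (m \x m)%E X)%E.
  by move=> mX; exact: product_measure_pair_map.
have kk0 : 0 <= k * k by rewrite mulr_ge0// ltW.
have main : \int[(m \x m)%E]_(z in pair_map f f @^-1` (A `*` B)) K' (pair_map f f z)
    = k * k * interaction m K' A B.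
  rewrite /interaction /Rintegral.
  rewrite (@ge0_integral_preimage _ _ _ _ _ (m \x m)%E (m \x m)%E
    (pair_map f f) (k * k) mff kk0 ffE (A `*` B) (fun z => (K' z)%:E) mAB).
  - rewrite fineM//; apply: integrable_fin_num => //.
  - by apply/measurable_EFinP; apply: measurable_funTS; case: gK'.
  - by move=> z _; rewrite lee_fin bounded_kernel_ge0.
rewrite -mulrA -main -RintegralZl.
- by apply: eq_Rintegral => -[x y] _; exact: KE.
- by rewrite -[X in measurable X]setTI; exact: mff.
- apply: measurable_bounded_integrable.
  + by rewrite -[X in measurable X]setTI; exact: mff.
  + have lt : ((k * k)%:E * (m \x m)%E (A `*` B) < +oo)%E.
      by apply: lte_mul_pinfty.
    by move: lt; rewrite -(ffE _ mAB).
  + apply: measurable_funTS; apply: measurableT_comp => //; by case: gK'.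
  + case: gK' => _ [C KC]; exists C; split; first exact: num_real.
    move=> x Cx z _ /=; have /andP[k0 kC] := KC (pair_map f f z).
    by rewrite ger0_norm// (le_trans kC)// ltW.
Qed.

End InteractionTransport.

Section HeatKernel.
Variable R : realType.
Local Notation M := (measurableTypeR R).
Local Notation V3 := (M * M * M)%type.
Local Notation mu := (@mu3 R).
Local Notation leb := (@lebesgue_measure R).

Definition heat1 (t : R) (z : M * M) : R :=
  (Num.sqrt (4 * pi * t))^-1 * expR (- ((z.1 - z.2) ^+ 2 / (4 * t))).

Definition heat3 (t : R) (z : V3 * V3) : R := heat_kernel z.1 z.2 t.

Definition inter1 (t : R) := interaction leb (heat1 t).
Definition inter3 (t : R) := interaction mu (heat3 t).

Lemma four_pi_gt0 (t : R) : 0 < t -> 0 < 4 * pi * t.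
Proof. by move=> t0; rewrite !mulr_gt0// pi_gt0. Qed.

Lemma heat3_heat1 (t : R) (x y : V3) : 0 < t ->
  heat3 t (x, y) = heat1 t (x.1.1, y.1.1) * heat1 t (x.1.2, y.1.2) * heat1 t (x.2, y.2).
Proof.
move=> t0; rewrite /heat3 /heat_kernel /heat1 /=.
set s := Num.sqrt (4 * pi * t).
have -> : (4 * pi * t) `^ (- (3 / 2)) = s^-1 * s^-1 * s^-1.
  have p := four_pi_gt0 t0.
  have sE : s^-1 = (4 * pi * t) `^ (2^-1 * -1).
    by rewrite powRrM powR12_sqrt ?ltW// powR_inv1// sqrtr_ge0.
  rewrite sE -!powRD ?(gt_eqF p) ?implybT//.
  by congr (_ `^ _); field.
rewrite [RHS](_ : _ = s^-1 * s^-1 * s^-1 *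
  (expR (- ((x.1.1 - y.1.1) ^+ 2 / (4 * t))) * expR (- ((x.1.2 - y.1.2) ^+ 2 / (4 * t)))
   * expR (- ((x.2 - y.2) ^+ 2 / (4 * t))))); last by ring.
congr (_ * _); rewrite -!expRD; congr expR; rewrite /dot /=.
by field; rewrite gt_eqF.
Qed.

Lemma measurable_heat1 t : measurable_fun setT (heat1 t).
Proof.
apply: measurable_funM => //; apply: measurableT_comp => //.
apply: measurable_funN; apply: measurable_funM => //.
by apply: measurable_funX; apply: measurable_funB.
Qed.

Lemma heat1_ge0 t z : 0 <= heat1 t z.
Proof. by rewrite mulr_ge0 ?expR_ge0// invr_ge0 sqrtr_ge0. Qed.

Lemma heat1_le t z : 0 < t -> heat1 t z <= (Num.sqrt (4 * pi * t))^-1.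
Proof.
move=> t0; rewrite ler_piMr ?invr_ge0 ?sqrtr_ge0// -[leRHS]expR0 ler_expR.
by rewrite oppr_le0 mulr_ge0 ?sqr_ge0// invr_ge0 mulr_ge0// ltW.
Qed.

Lemma heat1_bounded t : 0 < t -> bounded_kernel (heat1 t).
Proof.
move=> t0; split; first exact: measurable_heat1.
by exists (Num.sqrt (4 * pi * t))^-1 => z; rewrite heat1_ge0 heat1_le.
Qed.

Lemma heat1_sym t x y : heat1 t (x, y) = heat1 t (y, x).
Proof. by rewrite /heat1 /= -sqrrN opprB. Qed.

Lemma heat3_bounded t : 0 < t -> bounded_kernel (heat3 t).
Proof.
move=> t0; split; last first.
  exists ((Num.sqrt (4 * pi * t))^-1 ^+ 3) => -[x y].
  rewrite heat3_heat1// !mulr_ge0 ?heat1_ge0//=.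
  rewrite !exprS expr0 mulr1 mulrA.
  by rewrite !ler_pM ?mulr_ge0 ?heat1_ge0 ?heat1_le.
have -> : heat3 t = (fun z => heat1 t (z.1.1.1, z.2.1.1) * heat1 t (z.1.1.2, z.2.1.2)
    * heat1 t (z.1.2, z.2.2)).
  by apply/funext => -[x y]; rewrite heat3_heat1.
have mc (c : V3 -> M) : measurable_fun setT c ->
    measurable_fun setT (fun z : V3 * V3 => heat1 t (c z.1, c z.2)).
  move=> mc; apply: (measurableT_comp (measurable_heat1 t)).
  by apply: measurable_fun_pair; apply: measurableT_comp.
apply: measurable_funM; last exact: (mc _ (@measurable_co3 R)).
apply: measurable_funM; first exact: (mc _ (@measurable_co1 R)).
exact: (mc _ (@measurable_co2 R)).
Qed.

Lemma heat3_sym t x y : 0 < t -> heat3 t (x, y) = heat3 t (y, x).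
Proof.
move=> t0; rewrite !heat3_heat1//.
by rewrite (heat1_sym _ x.1.1) (heat1_sym _ x.1.2) (heat1_sym _ x.2).
Qed.

Lemma heat_content_inter3 (D : set V3) t : 0 < t -> measurable D ->
  heat_content D t = inter3 t D D.
Proof. by move=> t0 mD; rewrite /inter3 interactionE//; exact: heat3_bounded. Qed.

Lemma inter3_sym t A B : 0 < t -> measurable A -> measurable B ->
  inter3 t A B = inter3 t B A.
Proof.
move=> t0 mA mB; apply: interaction_sym => //; first exact: heat3_bounded.
by move=> x y; exact: heat3_sym.
Qed.

(** Parabolic scaling: lengths multiplied by [a], time by [a ^+ 2]. *)
Lemma inter3_scale (a t : R) b (A B : set V3) : 0 < a -> 0 < t ->
  fin_meas mu A -> fin_meas mu B ->
  inter3 t (affine3 a b @^-1` A) (affine3 a b @^-1` B)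
  = a ^- 3 * inter3 (a ^+ 2 * t) A B.
Proof.
move=> a0 t0 fA fB; have a2t : 0 < a ^+ 2 * t by rewrite mulr_gt0// exprn_gt0.
rewrite /inter3 (@interaction_preimage _ _ _ mu (affine3 a b) (a ^- 3) _ _ _ _
  (heat3 (a ^+ 2 * t)) (a ^+ 3))//.
- by congr (_ * _); field; rewrite gt_eqF.
- exact: measurable_affine3.
- by rewrite invr_gt0 exprn_gt0.
- move=> C mC; have := mu3_affine b (lt0r_neq0 a0) mC.
  by rewrite gtr0_norm.
- exact: heat3_bounded.
- move=> x y; rewrite !heat3_heat1// /heat1 /=.
  have -> : Num.sqrt (4 * pi * (a ^+ 2 * t)) = a * Num.sqrt (4 * pi * t).
    rewrite (_ : 4 * pi * (a ^+ 2 * t) = a ^+ 2 * (4 * pi * t)); last by ring.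
    by rewrite sqrtrM ?sqr_ge0// sqrtr_sqr gtr0_norm.
  have sc (u v w : R) : (a * u + w - (a * v + w)) ^+ 2 / (4 * (a ^+ 2 * t)) =
      (u - v) ^+ 2 / (4 * t).
    by field; rewrite !gt_eqF.
  rewrite /GRing.scale /= !sc.
  have s0 : Num.sqrt (4 * pi * t) != 0 by rewrite gt_eqF// sqrtr_gt0 four_pi_gt0.
  by field; rewrite s0 gt_eqF.
Qed.

Lemma inter3_frame_coords e t (A B : set V3) : orthonormal_frame e -> 0 < t ->
  fin_meas mu A -> fin_meas mu B ->
  inter3 t (frame_coords e @^-1` A) (frame_coords e @^-1` B) = inter3 t A B.
Proof.
move=> oe t0 fA fB.
rewrite /inter3 (@interaction_preimage _ _ _ mu (frame_coords e) 1 _ _ _ _ (heat3 t) 1)//.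
- by rewrite !mul1r.
- exact: measurable_frame_coords.
- by move=> C mC; rewrite mul1e; exact: mu3_frame_coords.
- exact: heat3_bounded.
- move=> x y; rewrite mul1r /heat3 /heat_kernel /=.
  by rewrite -frame_coordsB dot_frame_coords.
Qed.

End HeatKernel.

Section BoxInteraction.
Variable R : realType.
Local Notation M := (measurableTypeR R).
Local Notation V3 := (M * M * M)%type.
Local Notation mu := (@mu3 R).
Local Notation leb := (@lebesgue_measure R).

Lemma integral_mu3_box (I J K : set M) (f g h : M -> \bar R) :
  measurable I -> measurable J -> measurable K ->
  measurable_fun setT f -> measurable_fun setT g -> measurable_fun setT h ->
  (forall x, 0 <= f x)%E -> (forall x, 0 <= g x)%E -> (forall x, 0 <= h x)%E ->
  (\int[mu]_(z in I `*` J `*` K) (f z.1.1 * g z.1.2 * h z.2) =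
  \int[leb]_(x in I) f x * \int[leb]_(x in J) g x * \int[leb]_(x in K) h x)%E.
Proof.
move=> mI mJ mK mf mg mh f0 g0 h0.
have mfg : measurable_fun setT (fun z : M * M => f z.1 * g z.2)%E.
  by apply: emeasurable_funM; apply: measurableT_comp.
have fg0 (z : M * M) : (0 <= f z.1 * g z.2)%E by rewrite mule_ge0.
have E3 := @ge0_integral_setX_prod _ _ _ _ _ (@mu2 R) leb (I `*` J) K
  (fun z : M * M => f z.1 * g z.2)%E h (measurableX mI mJ) mK mfg mh fg0 h0.
have E2 := @ge0_integral_setX_prod _ _ _ _ _ leb leb I J f g mI mJ mf mg f0 g0.
apply: (etrans E3); congr (_ * _)%E; exact: E2.
Qed.

Definition heat1_pot (t : R) (J : set M) (x : M) : \bar R :=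
  (\int[leb]_(y in J) (heat1 t (x, y))%:E)%E.

Lemma heat1_pot_ge0 t J x : (0 <= heat1_pot t J x)%E.
Proof. by apply: integral_ge0 => y _; rewrite lee_fin heat1_ge0. Qed.

Lemma measurable_heat1_pot t J : measurable J -> measurable_fun setT (heat1_pot t J).
Proof.
move=> mJ.
have -> : heat1_pot t J =
    fubini_F leb ((fun z => (heat1 t z)%:E) \_ (setT `*` J)).
  apply/funext => x; rewrite /heat1_pot integral_mkcond /fubini_F.
  apply: (@eq_integral _ _ _ leb) => y _.
  by rewrite !patchE in_setX in_setT.
apply: measurable_fun_fubini_tonelli_F.
- apply/(measurable_restrictT _ (measurableX measurableT mJ)).
  by apply: measurable_funTS; apply/measurable_EFinP; exact: measurable_heat1.
- by move=> z; rewrite patchE; case: ifP => // _; rewrite lee_fin heat1_ge0.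
Qed.

Lemma inter1_pot t (I J : set M) : 0 < t -> measurable I -> measurable J ->
  inter1 t I J = fine (\int[leb]_(x in I) heat1_pot t J x)%E.
Proof.
by move=> t0 mI mJ; rewrite /inter1 interactionE//; exact: heat1_bounded.
Qed.

Lemma heat1_pot_fin t (I J : set M) : 0 < t -> fin_meas leb I -> fin_meas leb J ->
  (\int[leb]_(x in I) heat1_pot t J x)%E \is a fin_num.
Proof.
move=> t0 fI fJ; have iK := interaction_integrable (heat1_bounded t0) fI fJ.
have := integrable_fin_num (measurableX fI.1 fJ.1) iK.
rewrite (@ge0_integral_setX _ _ _ _ _ leb leb I J (fun z => (heat1 t z)%:E))//.
- by case: fI.
- by case: fJ.
- by apply/measurable_EFinP; exact: measurable_heat1.
- by move=> z; rewrite lee_fin heat1_ge0.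
Qed.

(** The heat kernel is the product of three one-dimensional kernels. *)
Lemma inter3_box t (I1 I2 I3 J1 J2 J3 : set M) : 0 < t ->
  fin_meas leb I1 -> fin_meas leb I2 -> fin_meas leb I3 ->
  fin_meas leb J1 -> fin_meas leb J2 -> fin_meas leb J3 ->
  inter3 t (I1 `*` I2 `*` I3) (J1 `*` J2 `*` J3) =
  inter1 t I1 J1 * inter1 t I2 J2 * inter1 t I3 J3.
Proof.
move=> t0 fI1 fI2 fI3 fJ1 fJ2 fJ3.
have mI : measurable (I1 `*` I2 `*` I3).
  by do 2?apply: measurableX; [case: fI1|case: fI2|case: fI3].
have mJ : measurable (J1 `*` J2 `*` J3).
  by do 2?apply: measurableX; [case: fJ1|case: fJ2|case: fJ3].
have mh x : measurable_fun setT (fun y => (heat1 t (x, y))%:E).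
  apply/measurable_EFinP.
  exact: (measurable_fun_pair2 x (measurable_heat1 t)).
have h0 x y : (0 <= (heat1 t (x, y))%:E)%E by rewrite lee_fin heat1_ge0.
rewrite /inter3 interactionE//; last exact: heat3_bounded.
rewrite !inter1_pot//; try by [case: fI1|case: fI2|case: fI3|case: fJ1|case: fJ2|case: fJ3].
rewrite -!fineM ?fin_numM ?heat1_pot_fin//; congr fine.
have E := integral_mu3_box fI1.1 fI2.1 fI3.1
  (measurable_heat1_pot t fJ1.1) (measurable_heat1_pot t fJ2.1) (measurable_heat1_pot t fJ3.1)
  (heat1_pot_ge0 t J1) (heat1_pot_ge0 t J2) (heat1_pot_ge0 t J3).
apply: (etrans _ E); apply: eq_integral => x _.
have E' := integral_mu3_box fJ1.1 fJ2.1 fJ3.1 (mh x.1.1) (mh x.1.2) (mh x.2)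
  (h0 x.1.1) (h0 x.1.2) (h0 x.2).
apply: (etrans _ E'); apply: eq_integral => y _.
by rewrite heat3_heat1// !EFinM.
Qed.

End BoxInteraction.

(** * Heat exchanged between intervals *)

Section OneDimensional.
Variable R : realType.
Local Notation M := (measurableTypeR R).
Local Notation leb := (@lebesgue_measure R).

(** From [u / m <= expR (u / m)] with u = c / t and m = n + 1, raised to the power
   m. It turns Gaussian tails into powers of t. *)
Lemma expRN_le_pow (n : nat) (c t : R) : 0 < c -> 0 < t ->
  expR (- (c / t)) <= (n.+1%:R / c) ^+ n.+1 * t ^+ n.+1.
Proof.
move=> c0 t0; set u := c / t.
have u0 : 0 < u by rewrite divr_gt0.
have n0 : 0 < n.+1%:R :> R by rewrite ltr0n.
have -> : - u = n.+1%:R * - (u / n.+1%:R).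
  by field; rewrite gt_eqF.
rewrite expRM_natl -exprMn lerXn2r ?nnegrE ?expR_ge0//.
  by rewrite mulr_ge0 ?divr_ge0// ltW.
have -> : n.+1%:R / c * t = (u / n.+1%:R)^-1.
  by rewrite /u; field; rewrite !gt_eqF.
rewrite expRN lef_pV2 ?posrE ?expR_gt0 ?divr_gt0//.
by apply: le_trans (expR_ge1Dx _); rewrite lerDr.
Qed.

Lemma heat1_pdf (t x y : R) : 0 < t ->
  heat1 t (x, y) = normal_pdf x (Num.sqrt (2 * t)) y.
Proof.
move=> t0; have t2 : 0 < 2 * t by rewrite mulr_gt0.
rewrite normal_pdfE ?gt_eqF ?sqrtr_gt0// /heat1 /normal_peak /normal_fun /=.
rewrite sqr_sqrtr ?ltW//; congr ((Num.sqrt _)^-1 * expR _).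
  by rewrite -mulr_natr; ring.
by rewrite -mulr_natr -mulNr; field; rewrite gt_eqF.
Qed.

(** The kernel [heat1 t (x, _)] is the density of the normal law of mean x and
   variance 2 t, so it has mass 1. *)
Lemma heat1_pot_setT (t x : R) : 0 < t -> heat1_pot t setT x = 1%E.
Proof.
move=> t0; rewrite /heat1_pot -(integral_normal_pdf x (Num.sqrt (2 * t))).
by apply: eq_integral => y _; rewrite heat1_pdf.
Qed.

Lemma measurable_heat1_slice (t x : R) :
  measurable_fun setT (fun y : M => (heat1 t (x, y))%:E).
Proof.
by apply/measurable_EFinP; exact: (measurable_fun_pair2 x (measurable_heat1 t)).
Qed.

(** Half of the exponent is bounded by its value at distance [delta]; the other
   half is, up to the factor [Num.sqrt 2], a heat kernel at time 2 t, whose mass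
   is at most 1. *)
Lemma heat1_pot_tail (t x delta : R) (S : set M) : 0 < t -> 0 <= delta -> measurable S ->
  (forall y, S y -> delta <= `|x - y|) ->
  (heat1_pot t S x <= (Num.sqrt 2 * expR (- (delta ^+ 2 / (8 * t))))%:E)%E.
Proof.
move=> t0 d0 mS Sd; have t2 : 0 < 2 * t by rewrite mulr_gt0.
have c0 : 0 <= Num.sqrt 2 * expR (- (delta ^+ 2 / (8 * t))) :> R.
  by rewrite mulr_ge0 ?sqrtr_ge0// expR_ge0.
set c := _ * expR _ in c0 *.
apply: (@le_trans _ _ (\int[leb]_(y in S) (c%:E * (heat1 (2 * t) (x, y))%:E)))%E.
  apply: ge0_le_integral => //.
  - by move=> y _; rewrite lee_fin heat1_ge0.
  - by apply: measurable_funTS; exact: measurable_heat1_slice.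
  - apply: measurable_funTS; apply: measurable_funeM.
    exact: measurable_heat1_slice.
  - move=> y Sy; rewrite -EFinM lee_fin /heat1 /=.
    have -> : 4 * pi * (2 * t) = 2 * (4 * pi * t) by ring.
    rewrite (sqrtrM (4 * pi * t)) // /c.
    rewrite [leRHS](_ : _ = (Num.sqrt (4 * pi * t))^-1 * (expR (- (delta ^+ 2 / (8 * t)))
      * expR (- ((x - y) ^+ 2 / (4 * (2 * t)))))); last first.
      by field; rewrite !gt_eqF ?sqrtr_gt0 ?four_pi_gt0.
    rewrite ler_wpM2l ?invr_ge0 ?sqrtr_ge0// -expRD ler_expR.
    have : delta ^+ 2 <= (x - y) ^+ 2.
      by rewrite -[leRHS]real_normK ?num_real// lerXn2r ?nnegrE ?Sd.
    move: (delta ^+ 2) ((x - y) ^+ 2) => p q pq.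
    have -> : - (q / (4 * t)) = - (q / (8 * t)) - q / (4 * (2 * t)).
      by field; rewrite gt_eqF.
    by rewrite lerD2r lerN2 ler_pM2r// invr_gt0 mulr_gt0.
rewrite ge0_integralZl//; last 2 first.
- by apply: measurable_funTS; exact: measurable_heat1_slice.
- by move=> y _; rewrite lee_fin heat1_ge0.
rewrite -[leRHS]mule1 lee_wpmul2l ?lee_fin//.
rewrite -(heat1_pot_setT x t2); apply: ge0_subset_integral => //.
- exact: measurable_heat1_slice.
- by move=> y _; rewrite lee_fin heat1_ge0.
Qed.

Lemma heat1_pot_le1 (t x : R) (S : set M) : 0 < t -> measurable S -> (heat1_pot t S x <= 1)%E.
Proof.
move=> t0 mS; rewrite -(heat1_pot_setT x t0); apply: ge0_subset_integral => //.
- exact: measurable_heat1_slice.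
- by move=> y _; rewrite lee_fin heat1_ge0.
Qed.

Lemma lebesgue_measure_oo (a b : R) : a <= b -> leb [set` `]a, b[] = (b - a)%:E.
Proof.
move=> ab; apply: (etrans (lebesgue_measure_itv `]a, b[)); rewrite /= lte_fin.
move: ab; rewrite le_eqVlt => /orP[/eqP->|ab]; first by rewrite ltxx subrr.
by rewrite ab EFinB.
Qed.

Lemma fin_meas_oo (a b : R) : fin_meas leb [set` `]a, b[].
Proof.
split; first exact: measurable_itv.
change (leb [set` `]a, b[] < +oo)%E.
have [ab|ba] := leP a b; first by rewrite lebesgue_measure_oo// ltry.
by rewrite set_itv_ge ?measure0// bnd_simp -leNgt ltW.
Qed.

(** All the heat released in ]a, b[ is found in J, except for a Gaussian tail, when
   J contains the [delta]-neighbourhood of ]a, b[. *)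
Lemma inter1_inside (t a b delta : R) (J : set M) : 0 < t -> 0 <= delta -> a <= b ->
  measurable J -> (forall x y, a < x < b -> `|x - y| < delta -> J y) ->
  (b - a) * (1 - Num.sqrt 2 * expR (- (delta ^+ 2 / (8 * t))))
    <= inter1 t [set` `]a, b[] J <= b - a.
Proof.
move=> t0 d0 ab mJ IJ; set I := [set` _].
have [mI fI] := fin_meas_oo a b; rewrite -/I in mI fI.
set c := Num.sqrt 2 * _.
rewrite inter1_pot//.
have up : (\int[leb]_(x in I) heat1_pot t J x <= (b - a)%:E)%E.
  rewrite -[leRHS]mul1e -(lebesgue_measure_oo ab) -integral_cst//.
  apply: ge0_le_integral => //.
  - by move=> x _; exact: heat1_pot_ge0.
  - by apply: measurable_funTS; exact: measurable_heat1_pot.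
  - by move=> x _; exact: heat1_pot_le1.
have fin : (\int[leb]_(x in I) heat1_pot t J x)%E \is a fin_num.
  rewrite ge0_fin_numE; first by apply: le_lt_trans up _; exact: ltry.
  by apply: integral_ge0 => x _; exact: heat1_pot_ge0.
apply/andP; split; last by rewrite -lee_fin fineK.
rewrite -lee_fin fineK// mulrC EFinM -(lebesgue_measure_oo ab).
have [c1|c1] := leP 0 (1 - c); last first.
  apply: (@le_trans _ _ 0%E); last by apply: integral_ge0 => x _; exact: heat1_pot_ge0.
  by rewrite mule_le0_ge0// lee_fin ltW.
rewrite -integral_cst//.
apply: ge0_le_integral => //.
- by apply: measurable_funTS; exact: measurable_heat1_pot.
- move=> x Ix.
  have mJc : measurable (~` J) by exact: measurableC.
  have H : (heat1_pot t J x + heat1_pot t (~` J) x = 1)%E.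
    rewrite -(heat1_pot_setT x t0) -(setvU J) setUC /heat1_pot.
    rewrite ge0_integral_setU//.
    + by rewrite setUv; exact: measurable_heat1_slice.
    + by move=> y _; rewrite lee_fin heat1_ge0.
    + by apply/disj_setPS; rewrite setICr.
  have fc : heat1_pot t (~` J) x \is a fin_num.
    rewrite ge0_fin_numE ?heat1_pot_ge0//.
    by apply: le_lt_trans (heat1_pot_le1 _ _ _) _ => //; exact: ltry.
  have -> : heat1_pot t J x = (1 - heat1_pot t (~` J) x)%E by rewrite -H addeK.
  rewrite EFinB leeB//; apply: heat1_pot_tail => // y nJy.
  rewrite leNgt; apply/negP => xy; apply: nJy; apply: (IJ x) => //.
Qed.

(** The integrand has an antiderivative, a multiple of the kernel itself. *)
Lemma integral_first_moment (t r : R) : 0 < t -> 0 < r ->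
  (\int[leb]_(z in [set` `]0%R, r[]) (z * heat1 t (0, z))%:E =
   (Num.sqrt (t / pi) * (1 - expR (- (r ^+ 2 / (4 * t)))))%:E)%E.
Proof.
move=> t0 r0; have pi0 := pi_gt0 R.
pose c : R := (Num.sqrt (4 * pi * t))^-1.
have cE : 2 * t * c = Num.sqrt (t / pi).
  rewrite /c; move: (pi : R) pi0 => p p0.
  rewrite (_ : 4 * p * t = (2 * t) ^+ 2 * (t / p)^-1); last first.
    by field; rewrite !gt_eqF.
  rewrite sqrtrM ?sqr_ge0// sqrtr_sqr gtr0_norm ?mulr_gt0// sqrtrV ?divr_ge0 ?ltW//.
  have s0 : 0 < Num.sqrt (t / p) by rewrite sqrtr_gt0 divr_gt0.
  by field; rewrite !gt_eqF.
pose F (z : R) : R := - (2 * t * c) * expR (- (z ^+ 2 / (4 * t))).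
pose f (z : R) : R := z * heat1 t (0, z).
have Fd (z : R) : is_derive z 1 F (f z).
  rewrite /F; apply: is_derive_eq.
  rewrite /f /heat1 /= -/c /GRing.scale /= sub0r sqrrN.
  rewrite !(scaler0, scale0r, mulr0, addr0, add0r, mulr1, expr1).
  by field; rewrite gt_eqF.
have fc : continuous f.
  move=> z; rewrite /f /heat1 /=.
  apply: cvgM; first exact: cvg_id.
  apply: cvgMr; apply: continuous_comp; last exact: continuous_expR.
  apply: cvgN; apply: cvgMl; rewrite expr2; apply: cvgM; apply: cvgB;
    by [apply: cvg_cst|apply: cvg_id].
rewrite -(@integral_itv_bndoo _ _ _ _ true false); last first.
  apply: measurable_funTS; apply/measurable_EFinP.
  by apply: continuous_measurable_fun.
rewrite (@continuous_FTC2 _ f F 0 r r0).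
- rewrite /F expr0n /= mul0r oppr0 expR0 mulr1 -EFinB cE; congr EFin; ring.
- by apply: continuous_subspaceT.
- have Fc (z : R) : {for z, continuous F}.
    by apply: differentiable_continuous; apply/derivable1_diffP; case: (Fd z).
  split; first by move=> z _; case: (Fd z).
  + by apply: cvg_at_right_filter; exact: Fc.
  + by apply: cvg_at_left_filter; exact: Fc.
- by move=> z _; rewrite derive1E; have := Fd z => -[_ ->].
Qed.

Lemma heat1_shift (t x z : R) : heat1 t (x, z + x) = heat1 t (0, z).
Proof. by rewrite /heat1 /=; have -> : x - (z + x) = 0 - z by ring. Qed.

(** To be used with [W z] equal to [heat1 t (0, z)] times the length of the set of
   the x in one interval such that x + z lies in the adjacent one. This length is
   the ramp z as long as z is smaller than both intervals, and at most l
   afterwards, where the kernel is a Gaussian tail. *)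
Lemma integral_ramp_bounds (t r l : R) (W : M -> \bar R) : 0 < t -> 0 < r -> r <= l ->
  (forall z, 0 <= W z)%E -> measurable_fun setT W ->
  (forall z, [set` `]0, r[] z -> W z = (z * heat1 t (0, z))%:E) ->
  (forall z, W z <= l%:E * (heat1 t (0, z))%:E)%E ->
  (forall z : R, z <= 0 -> W z = 0%E) ->
  ((Num.sqrt (t / pi) * (1 - expR (- (r ^+ 2 / (4 * t)))))%:E
    <= \int[leb]_z W z
    <= (Num.sqrt (t / pi) * (1 - expR (- (r ^+ 2 / (4 * t))))
       + l * (Num.sqrt 2 * expR (- (r ^+ 2 / (8 * t)))))%:E)%E.
Proof.
move=> t0 r0 rl W0 mW W1 Wle Wneg.
pose P : set M := [set` `]0, r[]; pose Q : set M := [set` `[r, +oo[].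
have mP : measurable P by exact: measurable_itv.
have mQ : measurable Q by exact: measurable_itv.
have EP : (\int[leb]_(z in P) W z =
    (Num.sqrt (t / pi) * (1 - expR (- (r ^+ 2 / (4 * t)))))%:E)%E.
  rewrite -(integral_first_moment t0 r0); apply: eq_integral => z /set_mem; exact: W1.
have EQ : (\int[leb]_(z in Q) W z <=
    (l * (Num.sqrt 2 * expR (- (r ^+ 2 / (8 * t)))))%:E)%E.
  have mg := measurable_heat1_slice t 0.
  have mgQ : measurable_fun Q (fun z => (heat1 t (0, z))%:E) by exact: measurable_funTS.
  have gQ0 z : Q z -> (0 <= (heat1 t (0, z))%:E)%E by rewrite lee_fin heat1_ge0.
  have l0 : (0 <= l%:E)%E by rewrite lee_fin; lra.
  have mWQ : measurable_fun Q W by exact: measurable_funTS.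
  have mbg : measurable_fun Q (fun z => l%:E * (heat1 t (0%R, z))%:E)%E.
    exact: measurable_funeM.
  apply: (@le_trans _ _ (\int[leb]_(z in Q) (l%:E * (heat1 t (0%R, z))%:E)))%E.
    exact: (ge0_le_integral leb mQ (fun z _ => W0 z) mWQ mbg (fun z _ => Wle z)).
  rewrite (ge0_integralZl leb mQ mgQ gQ0 l0) EFinM; apply: lee_wpmul2l => //.
  apply: heat1_pot_tail => //; first exact: ltW.
  by move=> y; rewrite /Q /= in_itv /= andbT sub0r normrN => ry; rewrite ger0_norm//; lra.
have mWU : measurable_fun (P `|` Q) W by exact: measurable_funTS.
have dPQ : [disjoint P & Q].
  apply/disj_setPRL => z; rewrite /P /Q /= !in_itv /= andbT => rz /andP[_ zr].
  by lra.
have EPQ : (\int[leb]_z W z = \int[leb]_(z in P) W z + \int[leb]_(z in Q) W z)%E.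
  rewrite -(ge0_integral_setU leb mP mQ mWU (fun z _ => W0 z) dPQ).
  rewrite [RHS]integral_mkcond; apply: eq_integral => z _.
  rewrite patchE; case: ifPn => // /negP nz; apply: Wneg; rewrite leNgt.
  apply/negP => z0; apply: nz; apply/mem_set; rewrite /P /Q /= !in_itv /= andbT z0 /=.
  by have [|] := ltP z r; [left|right].
rewrite EPQ EP EFinD; apply/andP; split; last exact: leeD2l.
by apply: leeDl; apply: integral_ge0 => z _.
Qed.

(** Substitute y = x + z and integrate first over x, at fixed displacement z. *)
Lemma inter1_adjacent (t a b d r : R) : 0 < t -> 0 < r ->
  r <= b - a -> r <= d - b ->
  Num.sqrt (t / pi) * (1 - expR (- (r ^+ 2 / (4 * t))))
    <= inter1 t [set` `]a, b[] [set` `]b, d[]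
    <= Num.sqrt (t / pi) * (1 - expR (- (r ^+ 2 / (4 * t))))
       + (b - a) * (Num.sqrt 2 * expR (- (r ^+ 2 / (8 * t)))).
Proof.
move=> t0 r0 ra rd; set I := [set` `]a, b[]; set J := [set` `]b, d[].
have [mI fI] := fin_meas_oo a b; have [mJ fJ] := fin_meas_oo b d.
rewrite -/I in mI fI; rewrite -/J in mJ fJ.
pose g (z : M) : R := heat1 t (0, z).
have g0 z : 0 <= g z by exact: heat1_ge0.
have mg : measurable_fun setT (fun z => (g z)%:E) by exact: measurable_heat1_slice.
pose S : set (M * M) := [set p | I p.1 /\ J (affine1 1 p.1 p.2)].
have mS : measurable S.
  rewrite (_ : S = (fst @^-1` I) `&` ((fun p : M * M => p.2 + p.1 : M) @^-1` J)); last first.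
    by apply/seteqP; split => p /=; rewrite /S /affine1 /= mul1r.
  apply: measurableI; rewrite -[X in measurable X]setTI.
    exact: measurable_fst.
  have := @measurable_funD _ _ R setT _ _ (@measurable_snd _ _ M M) (@measurable_fst _ _ M M).
  exact.
pose F := (fun p : M * M => (g p.2)%:E : \bar R) \_ S.
have F0 p : (0 <= F p)%E by rewrite /F patchE; case: ifP => // _; rewrite lee_fin.
have mF : measurable_fun setT F.
  apply/(measurable_restrictT _ mS); apply: measurable_funTS.
  exact: (measurableT_comp mg).
have E1 : (\int[leb]_(x in I) heat1_pot t J x = \int[leb]_x \int[leb]_z F (x, z))%E.
  rewrite integral_mkcond; apply: eq_integral => x _.
  rewrite patchE; case: ifPn => xI; last first.
    apply/esym; apply: integral0_eq => z _; rewrite /F patchE.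
    by case: ifPn => // /set_mem [/= Ix _]; rewrite notin_setE in xI.
  rewrite /heat1_pot.
  have := @ge0_integral_preimage _ _ _ _ _ leb leb (affine1 1 x) 1
    (measurable_affine1 1 x) ler01 _ J (fun y => (heat1 t (x, y))%:E) mJ.
  rewrite mul1e => <-; last 3 first.
  - move=> A mA; have := lebesgue_measure_affine_gt0 x ltr01 mA.
    by rewrite invr1.
  - by apply: measurable_funTS; exact: measurable_heat1_slice.
  - by move=> y _; rewrite lee_fin heat1_ge0.
  rewrite integral_mkcond; apply: eq_integral => z _.
  rewrite /F !patchE; congr (if _ then _ else _).
    by apply/idP/idP => /set_mem H; apply/mem_set => //=; [split => //; exact/set_mem|case: H].
  by rewrite /affine1 mul1r heat1_shift.
pose W (z : M) : \bar R := (\int[leb]_x F (x, z))%E.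
have W0 z : (0 <= W z)%E by exact: integral_ge0.
have mW : measurable_fun setT W by exact: measurable_fun_fubini_tonelli_G.
have mSz z : measurable [set x | S (x, z)].
  rewrite (_ : [set x | S (x, z)] = ysection S z); first exact: measurable_ysection.
  by apply/seteqP; split => x; rewrite /ysection /= inE.
have WE z : W z = ((g z)%:E * leb [set x | S (x, z)])%E.
  rewrite -integral_cst// integral_mkcond; apply: eq_integral => x _.
  rewrite /F !patchE; have -> // : ((x, z) \in S) = (x \in [set x | S (x, z)]).
  by apply/idP/idP; rewrite !inE.
have W1 z : [set` `]0, r[] z -> W z = (z * heat1 t (0, z))%:E.
  rewrite /= in_itv /= => /andP[z0 zr].
  rewrite WE (_ : [set x | S (x, z)] = [set` `](b - z), b[]); last first.
    apply/seteqP; split => x; rewrite /S /I /J /affine1 /= !in_itv /= mul1r.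
      by move=> [/andP[? ?] /andP[? ?]]; apply/andP; split; lra.
    by move=> /andP[? ?]; split; apply/andP; split; lra.
  rewrite lebesgue_measure_oo; last by lra.
  by rewrite -EFinM /g; congr EFin; ring.
have Wle z : (W z <= (b - a)%:E * (g z)%:E)%E.
  rewrite WE muleC; apply: lee_wpmul2r; first by rewrite lee_fin.
  rewrite -lebesgue_measure_oo; last by lra.
  apply: le_measure; rewrite ?inE//.
  by move=> x [].
have Wneg (z : R) : z <= 0 -> W z = 0%E.
  move=> z0; rewrite WE (_ : [set x | S (x, z)] = set0) ?measure0 ?mule0//.
  apply/seteqP; split => x //; rewrite /S /I /J /affine1 /= !in_itv /= mul1r.
  by move=> [/andP[? ?] /andP[? ?]]; lra.
have E2 : (\int[leb]_(x in I) heat1_pot t J x = \int[leb]_z W z)%E.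
  by apply: (etrans E1); exact: (fubini_tonelli F mF F0).
have /andP[lo hi] := integral_ramp_bounds t0 r0 ra W0 mW W1 Wle Wneg.
have fin : (\int[leb]_z W z)%E \is a fin_num.
  rewrite ge0_fin_numE; last exact: integral_ge0.
  exact: le_lt_trans hi (ltry _).
by rewrite inter1_pot// E2 -!lee_fin fineK// lo hi.
Qed.

End OneDimensional.

Section NullSets.
Context d (T : measurableType d) (R : realType).
Variable m : {sigma_finite_measure set T -> \bar R}.
Implicit Types (K : T * T -> R) (A B : set T).

Lemma interaction_null K A B : bounded_kernel K -> fin_meas m A -> fin_meas m B ->
  m A = 0%E -> interaction m K A B = 0.
Proof.
move=> gK fA fB A0; apply/eqP; rewrite eq_le interaction_ge0// andbT.
have [C KC] := gK.2.
have := @interaction_le _ _ _ m K C A B gK fA fB.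
by rewrite A0 /= mul0r mulr0; apply => x y _ _; case/andP: (KC (x, y)).
Qed.

Lemma interaction_ae K A A' B : bounded_kernel K -> fin_meas m A -> fin_meas m A' ->
  fin_meas m B -> A `<=` A' -> m (A' `\` A) = 0%E ->
  interaction m K A' B = interaction m K A B.
Proof.
move=> gK fA fA' fB AA' D0.
have fD : fin_meas m (A' `\` A).
  by split; [apply: measurableD; [case: fA'|case: fA]|rewrite D0 ltry].
rewrite -[in LHS](setDUK AA') interactionUl// ?setDIK//.
by rewrite (interaction_null gK fD fB)// addr0.
Qed.

Lemma interactionUr K A B1 B2 : bounded_kernel K -> (forall x y, K (x, y) = K (y, x)) ->
  fin_meas m A -> fin_meas m B1 -> fin_meas m B2 -> B1 `&` B2 = set0 ->
  interaction m K A (B1 `|` B2) = interaction m K A B1 + interaction m K A B2.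
Proof.
move=> gK Ks fA f1 f2 dB; have fU := fin_measU f1 f2.
rewrite !(interaction_sym m gK Ks fA.1) ?interactionUl//;
  [exact: f2.1|exact: f1.1|exact: fU.1].
Qed.

End NullSets.

Section OneDimensionalExpansions.
Variable R : realType.
Local Notation M := (measurableTypeR R).
Local Notation leb := (@lebesgue_measure R).
Local Notation S t := (Num.sqrt (t / pi)).

Lemma inter1_sym (t : R) (A B : set M) : 0 < t -> measurable A -> measurable B ->
  inter1 t A B = inter1 t B A.
Proof.
move=> t0 mA mB; apply: interaction_sym => //; first exact: heat1_bounded.
by move=> x y; exact: heat1_sym.
Qed.

(** Heat released in an interval stays in it or crosses one of its ends: subtract
   from the heat that remains in a tripled interval what goes to the two
   neighbours, each of which receives [S t] up to a Gaussian tail. *)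
Lemma inter1_self (t a b : R) : 0 < t -> a < b ->
  `|inter1 t [set` `]a, b[] [set` `]a, b[] - (b - a - 2 * S t)|
  <= 3 * (b - a) * (Num.sqrt 2 * expR (- ((b - a) ^+ 2 / (8 * t))))
     + 2 * S t * expR (- ((b - a) ^+ 2 / (4 * t))).
Proof.
move=> t0 ab; set l := b - a.
pose A : set M := [set` `]a, b[]; pose L : set M := [set` `]a - l, a[].
pose N : set M := [set` `]b, b + l[]; pose J : set M := [set` `]a - l, b + l[].
have l0 : 0 < l by rewrite subr_gt0.
have al : b = a + l by rewrite /l; ring.
have fA : fin_meas leb A by exact: fin_meas_oo.
have fL : fin_meas leb L by exact: fin_meas_oo.
have fN : fin_meas leb N by exact: fin_meas_oo.
have fJ : fin_meas leb J by exact: fin_meas_oo.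
have gK := heat1_bounded t0.
have Ks x y : heat1 t (x, y) = heat1 t (y, x) by exact: heat1_sym.
have decomp : inter1 t A J = inter1 t L A + inter1 t A A + inter1 t A N.
  have dLA : L `&` A = set0.
    apply/seteqP; split => x //=; rewrite /L /A /= !in_itv /=.
    by move=> [/andP[? ?] /andP[? ?]]; lra.
  have dLAN : (L `|` A) `&` N = set0.
    apply/seteqP; split => x //=; rewrite /L /A /N /= !in_itv /=.
    by move=> [[/andP[? ?]|/andP[? ?]] /andP[? ?]]; lra.
  have fLA := fin_measU fL fA; have fLAN := fin_measU fLA fN.
  rewrite (inter1_sym t0 fA.1 fJ.1) /inter1.
  rewrite (@interaction_ae _ _ _ leb _ (L `|` A `|` N) J A gK fLAN fJ fA).
  - rewrite interactionUl// interactionUl//; congr (_ + _).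
    exact: (inter1_sym t0 fN.1 fA.1).
  - move=> x; rewrite /L /A /N /J /= !in_itv /=.
    by move=> [[|]|] /andP[? ?]; apply/andP; split; lra.
  - apply/eqP; rewrite eq_le measure_ge0 andbT.
    apply: (@le_trans _ _ (leb ([set a] `|` [set b]))).
      apply: le_measure; rewrite ?inE.
      + by apply: measurableD; [case: fJ|case: fLAN].
      + by apply: measurableU; exact: measurable_set1.
      + move=> x [] /=; rewrite /L /A /N /J /= !in_itv /= => /andP[x1 x2] nx.
        have [xa|xa|->] := ltgtP x a; last by left.
          by exfalso; apply: nx; left; left; rewrite x1 xa.
        have [xb|xb|->] := ltgtP x b; last by right.
          by exfalso; apply: nx; left; right; rewrite xa xb.
        by exfalso; apply: nx; right; rewrite xb x2.
    apply: (@le_trans _ _ (leb [set a] + leb [set b])%E).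
      by apply: measureU2; exact: measurable_set1.
    by rewrite !lebesgue_measure_set1 adde0.
have in1 : (b - a) * (1 - Num.sqrt 2 * expR (- (l ^+ 2 / (8 * t)))) <= inter1 t A J <= b - a.
  apply: inter1_inside => //; [exact: ltW|exact: ltW|by case: fJ|].
  move=> x y /andP[? ?]; rewrite ltr_norml => /andP[? ?].
  by rewrite /J /= in_itv /=; apply/andP; split; lra.
have adjR := @inter1_adjacent _ t a b (b + l) l t0 l0.
have adjL := @inter1_adjacent _ t (a - l) a b l t0 l0.
have {}adjR := adjR ltac:(rewrite /l; lra) ltac:(lra).
have {}adjL := adjL ltac:(lra) ltac:(rewrite /l; lra).
rewrite -/A -/L -/N -/l in in1 adjR adjL *.
move: in1 adjR adjL decomp.
have -> : a - (a - l) = l by ring.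
have E0 := expR_ge0 (- (l ^+ 2 / (8 * t))).
have e0 := expR_ge0 (- (l ^+ 2 / (4 * t))).
have S0 : 0 <= S t by exact: sqrtr_ge0.
have s0 : 0 <= Num.sqrt 2 :> R by exact: sqrtr_ge0.
move: (expR _) E0 => E E0; move: (expR _) e0 => e1 e10.
move: (S t) S0 (Num.sqrt 2) s0 => s s0 q q0.
have qE : 0 <= q * E by exact: mulr_ge0.
move: (q * E) qE => {q0} Z Z0.
move=> /andP[h1 h2] /andP[h3 h4] /andP[h5 h6] h7.
have sp : 0 <= s * e1 by exact: mulr_ge0.
have lZ : 0 <= l * Z by rewrite mulr_ge0// ltW.
rewrite ler_norml; apply/andP; split; nra.
Qed.

End OneDimensionalExpansions.

Section CubeExpansions.
Variable R : realType.
Local Notation M := (measurableTypeR R).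
Local Notation S t := (Num.sqrt (t / pi)).

Lemma gauss_exp_small (delta t : R) : 0 < delta -> 0 < t ->
  expR (- (delta ^+ 2 / (8 * t))) <= (16 / delta ^+ 2) ^+ 2 * t ^+ 2 /\
  expR (- (delta ^+ 2 / (4 * t))) <= (16 / delta ^+ 2) ^+ 2 * t ^+ 2.
Proof.
move=> d0 t0; have d20 : 0 < delta ^+ 2 by rewrite exprn_gt0.
have E8 : expR (- (delta ^+ 2 / (8 * t))) <= (16 / delta ^+ 2) ^+ 2 * t ^+ 2.
  have -> : delta ^+ 2 / (8 * t) = delta ^+ 2 / 8 / t by rewrite invfM mulrA.
  apply: le_trans (@expRN_le_pow R 1 _ _ _ t0) _; first by rewrite divr_gt0.
  rewrite ler_pM2r ?exprn_gt0// le_eqVlt; apply/orP; left; apply/eqP.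
  by congr (_ ^+ _); field; rewrite gt_eqF.
split=> //; apply: le_trans E8; rewrite ler_expR lerN2 ler_pM2l//.
by rewrite lef_pV2 ?posrE ?mulr_gt0// ler_pM2r// ler_nat.
Qed.

Lemma sqrt_div_pi_le1 (t : R) : 0 < t -> t <= 1 -> 0 <= S t <= 1.
Proof.
move=> t0 t1; rewrite sqrtr_ge0 -sqrtr1 ler_sqrt//.
by rewrite ler_pdivrMr ?pi_gt0// mul1r (le_trans t1)// (le_trans _ (pi_ge2 R))// ler1n.
Qed.

Lemma inter1_ge0 (t : R) (A B : set M) : 0 < t -> 0 <= inter1 t A B.
Proof. by move=> t0; apply: interaction_ge0; exact: heat1_bounded. Qed.

Lemma inter1_le_length (t a b : R) (J : set M) : 0 < t -> a <= b -> measurable J ->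
  inter1 t [set` `]a, b[] J <= b - a.
Proof.
move=> t0 ab mJ.
have IJ x y : a < x < b -> `|x - y| < 0 -> J y by rewrite normr_lt0.
by have /andP[] := inter1_inside t0 (lexx 0) ab mJ IJ.
Qed.

Lemma inter1_self_expansion (a b : R) : a < b -> exists2 C : R, 0 <= C &
  forall t, 0 < t -> t <= 1 ->
  `|inter1 t [set` `]a, b[] [set` `]a, b[] - (b - a - 2 * S t)| <= C * t ^+ 2.
Proof.
move=> ab; set l := b - a; have l0 : 0 < l by rewrite subr_gt0.
pose D := (16 / l ^+ 2) ^+ 2.
have D0 : 0 <= D by exact: sqr_ge0.
exists ((3 * l * Num.sqrt 2 + 2) * D).
  by rewrite mulr_ge0// addr_ge0// mulr_ge0 ?sqrtr_ge0// mulr_ge0// ltW.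
move=> t t0 t1; apply: le_trans (inter1_self t0 ab) _; rewrite -/l.
have [E8 E4] := gauss_exp_small l0 t0.
rewrite -/D in E8 E4.
have /andP[S0 S1] := sqrt_div_pi_le1 t0 t1.
rewrite (mulrDl (3 * l * Num.sqrt 2)) (mulrDl (_ * D)); apply: lerD.
  rewrite -(mulrA (3 * l)) -(mulrA (3 * l)).
  rewrite ler_wpM2l ?mulr_ge0 ?(ltW l0)// -(mulrA (Num.sqrt 2)).
  by rewrite ler_wpM2l ?sqrtr_ge0.
rewrite -(mulrA 2) -(mulrA 2) ler_wpM2l//; apply: le_trans E4.
by rewrite -[leRHS]mul1r ler_wpM2r ?expR_ge0.
Qed.

Lemma inter1_inside_expansion (a b delta : R) (J : set M) : a < b -> 0 < delta ->
  measurable J -> (forall x y, a < x < b -> `|x - y| < delta -> J y) ->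
  exists2 C : R, 0 <= C & forall t, 0 < t -> t <= 1 ->
  `|inter1 t [set` `]a, b[] J - (b - a)| <= C * t ^+ 2.
Proof.
move=> ab d0 mJ IJ; have l0 : 0 < b - a by rewrite subr_gt0.
pose D := (16 / delta ^+ 2) ^+ 2.
exists ((b - a) * (Num.sqrt 2 * D)).
  by rewrite mulr_ge0 ?(ltW l0)// mulr_ge0 ?sqrtr_ge0// sqr_ge0.
move=> t t0 t1.
have /andP[lo hi] := @inter1_inside _ t a b delta J t0 (ltW d0) (ltW ab) mJ IJ.
have [E8 _] := gauss_exp_small d0 t0.
rewrite -/D in E8.
rewrite ler0_norm ?subr_le0// opprB lerBlDr -lerBlDl; apply: le_trans lo.
rewrite mulrBr mulr1 lerB// -(mulrA (b - a)) ler_wpM2l ?(ltW l0)//.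
by rewrite -(mulrA (Num.sqrt 2)) ler_wpM2l ?sqrtr_ge0.
Qed.

Lemma inter1_adjacent_expansion (a b d : R) : a < b -> b < d ->
  exists2 C : R, 0 <= C & forall t, 0 < t -> t <= 1 ->
  `|inter1 t [set` `]a, b[] [set` `]b, d[] - S t| <= C * t ^+ 2.
Proof.
move=> ab bd; pose r := Num.min (b - a) (d - b).
have r0 : 0 < r by rewrite lt_min !subr_gt0 ab bd.
have ra : r <= b - a by rewrite ge_min lexx.
have rd : r <= d - b by rewrite ge_min lexx orbT.
have l0 : 0 < b - a by rewrite subr_gt0.
pose D := (16 / r ^+ 2) ^+ 2.
have D0 : 0 <= D by exact: sqr_ge0.
exists (D + (b - a) * (Num.sqrt 2 * D)).
  by rewrite addr_ge0// mulr_ge0 ?(ltW l0)// mulr_ge0 ?sqrtr_ge0.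
move=> t t0 t1.
have /andP[lo hi] := inter1_adjacent t0 r0 ra rd.
have [E8 E4] := gauss_exp_small r0 t0.
rewrite -/D in E8 E4.
have /andP[S0 S1] := sqrt_div_pi_le1 t0 t1.
have e4 := expR_ge0 (- (r ^+ 2 / (4 * t))).
have q1 : S t * expR (- (r ^+ 2 / (4 * t))) <= D * t ^+ 2.
  apply: le_trans E4; rewrite -[leRHS]mul1r ler_wpM2r//; lra.
have q2 : (b - a) * (Num.sqrt 2 * expR (- (r ^+ 2 / (8 * t)))) <=
    (b - a) * (Num.sqrt 2 * D) * t ^+ 2.
  rewrite -(mulrA (b - a)) ler_wpM2l ?(ltW l0)//.
  by rewrite -(mulrA (Num.sqrt 2)) ler_wpM2l ?sqrtr_ge0.
have q3 : 0 <= (b - a) * (Num.sqrt 2 * D) * t ^+ 2.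
  by rewrite mulr_ge0 ?sqr_ge0// mulr_ge0 ?(ltW l0)// mulr_ge0 ?sqrtr_ge0.
have q4 : 0 <= D * t ^+ 2 by rewrite mulr_ge0// sqr_ge0.
have q5 : 0 <= S t * expR (- (r ^+ 2 / (4 * t))) by rewrite mulr_ge0.
rewrite mulrBr mulr1 in lo hi.
rewrite (mulrDl D).
move: (inter1 _ _ _) (S t) (S t * expR _) ((b - a) * (Num.sqrt 2 * expR _))
  ((b - a) * (Num.sqrt 2 * D) * t ^+ 2) (D * t ^+ 2) lo hi
  q1 q2 q3 q4 q5 {E8 E4 S0 S1 e4} => i s u v w z lo hi q1 q2 q3 q4 q5.
rewrite ler_norml; apply/andP; split; lra.
Qed.

End CubeExpansions.

(** * Cubes, towers and self-similarity *)

Section Geometry.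
Variable R : realType.
Local Notation M := (measurableTypeR R).
Local Notation V3 := (M * M * M)%type.
Local Notation mu := (@mu3 R).
Variable e : 'I_3 -> R * R * R.
Hypothesis oe : orthonormal_frame e.
Implicit Types (c x y : R * R * R) (a t : R) (f g h : face).

Local Notation s := (5^-1 : R).
Definition face_coord c g x : R := dot (x - c) (normal e g).

Definition may_follow f g : bool := g != opposite f.

Definition child c a g : R * R * R := face_centre e c a g + (s * a / 2) *: normal e g.

(** What grows from a cube attached through the face f, this cube included; no
   sequence that starts with [opposite f] is followed. *)
Definition tower c a f : set V3 :=
  \bigcup_(w in [set w | path may_follow f w]) attached_cube e s c a w.

Lemma towerE c a f :
  tower c a f = open_cube e c a `|`
    \bigcup_(g in [set g | may_follow f g]) tower (child c a g) (s * a) g.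
Proof.
apply/seteqP; split => x.
  move=> [[|g w] /=]; first by move=> _ xQ; left.
  by move=> /andP[fg gw] xw; right; exists g => //; exists w.
move=> [xQ|[g /= fg [w /= gw xw]]]; first by exists [::].
by exists (g :: w) => //=; rewrite fg.
Qed.

Lemma attached_cubesE c a :
  \bigcup_(w in [set w | admissible w]) attached_cube e s c a w =
  open_cube e c a `|` \bigcup_g tower (child c a g) (s * a) g.
Proof.
apply/seteqP; split => x.
  move=> [[|g w] /=]; first by move=> _ xQ; left.
  by move=> gw xw; right; exists g => //; exists w.
move=> [xQ|[g /= _ [w /= gw xw]]]; first by exists [::].
by exists (g :: w) => //=.
Qed.

Lemma oppositeK : involutive opposite.
Proof. by case=> i b; rewrite /opposite /= negbK. Qed.

Lemma dotNr x y : dot x (- y) = - dot x y.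
Proof. by rewrite dotC dotNl dotC. Qed.

Lemma normal_opposite g : normal e (opposite g) = - normal e g.
Proof. by case: g => i [] /=; rewrite /normal /= ?opprK. Qed.

Lemma dot_normal g h :
  dot (normal e g) (normal e h) = (g == h)%:R - (g == opposite h)%:R.
Proof.
case: g h => i b [j b']; rewrite /opposite /normal /= !xpair_eqE.
have E : dot (e i) (e j) = (i == j)%:R by exact: oe.
by case: b; case: b' => /=; rewrite ?dotNl ?dotNr E ?andbT ?andbF ?opprK ?subr0 ?sub0r.
Qed.

Lemma childE c a g : child c a g = c + (3 / 5 * a) *: normal e g.
Proof.
rewrite /child /face_centre -addrA -scalerDl; congr (_ + _ *: _).
by field.
Qed.

Lemma face_coord_child x c a g h : face_coord (child c a g) h x =
  face_coord c h x - 3 / 5 * a * ((g == h)%:R - (g == opposite h)%:R).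
Proof.
rewrite /face_coord childE.
have -> : x - (c + (3 / 5 * a) *: normal e g) = (x - c) - (3 / 5 * a) *: normal e g.
  by rewrite opprD addrA.
by rewrite (dotBl (x - c)) dotZl dot_normal.
Qed.

Lemma face_coord_opposite x c g : face_coord c (opposite g) x = - face_coord c g x.
Proof. by rewrite /face_coord normal_opposite dotNr. Qed.

Lemma open_cubeP c a x : open_cube e c a x <-> forall g, face_coord c g x < a / 2.
Proof.
split=> H.
  move=> [i []]; have := H i; rewrite ltr_norml /face_coord /normal /= => /andP[h1 h2] //.
  by rewrite dotNr ltrNl.
move=> i; rewrite ltr_norml (H (i, true)) andbT.
by have := H (i, false); rewrite /face_coord /normal /= dotNr ltrNl.
Qed.

(** Bounding box of a tower. The height above the centre in any direction is at
   most [a / 2 + a / 5 + a / 25 + ... = 3 / 4 * a]. Behind the face f, nothing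
   grows on the cube itself, and what grows on the lateral faces reaches back at
   most [3 / 4 * (a / 5)], which is less than [a / 2]. This box is what keeps the
   pieces of the construction disjoint. *)
Lemma tower_box c a f x : 0 < a -> tower c a f x ->
  (forall g, face_coord c g x <= 3 / 4 * a) /\ - (a / 2) < face_coord c f x.
Proof.
move=> a0 [w /= + xw]; elim: w f c a a0 xw => [|g w IH] f c a a0 /=.
  move=> /open_cubeP xQ _; split.
    by move=> g; have := xQ g; lra.
  by have := xQ (opposite f); rewrite face_coord_opposite; lra.
(* The bounds are invariant under one step of the recursion:
   3/5 + (3/4)/5 = 3/4 on the axis of g, and (3/4)/5 < 1/2 behind f. *)
move=> xw /andP[fg gw]; have sa0 : 0 < s * a by rewrite mulr_gt0.
have [hi lo] := IH g (child c a g) (s * a) sa0 xw gw.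
split.
  move=> h; have := hi h; rewrite face_coord_child.
  have [->|gh] := eqVneq g h; have [_|_] := eqVneq _ (opposite h);
    rewrite /= ?mulr1n ?mulr0n => H; lra.
have gf : (g == opposite f) = false by apply/negbTE.
have := hi (opposite f); rewrite face_coord_child face_coord_opposite oppositeK gf.
by have [_|_] := eqVneq g f; rewrite /= ?mulr1n ?mulr0n => H; lra.
Qed.

Definition oitv (p a : R) : set M := [set` `]p - a / 2, p + a / 2[].
Definition citv (p a : R) : set M := [set` `[p - a / 2, p + a / 2]].

Definition closed_cube c a : set V3 := [set x | forall g, face_coord c g x <= a / 2].

Lemma ltr_norm_itv (u p l : R) : (`|u - p| < l) = (u \in `]p - l, p + l[).
Proof. by rewrite in_itv /= ltr_norml ltrBlDr ltrBrDr addrC (addrC l). Qed.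

Lemma ler_norm_itv (u p l : R) : (`|u - p| <= l) = (u \in `[p - l, p + l]).
Proof. by rewrite in_itv /= ler_norml lerBlDr lerBrDr addrC (addrC l). Qed.

Lemma open_cube_preimage c a : open_cube e c a = frame_coords e @^-1`
  (oitv (dot c (e i0)) a `*` oitv (dot c (e i1)) a `*` oitv (dot c (e i2)) a).
Proof.
apply/seteqP; split => x.
  move=> H; have K i : dot x (e i) \in `]dot c (e i) - a / 2, dot c (e i) + a / 2[.
    by rewrite -ltr_norm_itv -dotBl; exact: H.
  by split; [split|]; exact: K.
move=> [[h0 h1] h2]; apply: ord3P; by rewrite dotBl ltr_norm_itv.
Qed.

Lemma closed_cubeP c a x : closed_cube c a x <-> forall i, `|dot (x - c) (e i)| <= a / 2.
Proof.
split=> H.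
  move=> i; rewrite ler_norml (H (i, true)) andbT.
  by have := H (i, false); rewrite /face_coord /normal /= dotNr lerNl.
move=> [i []]; have := H i; rewrite ler_norml /face_coord /normal /= => /andP[h1 h2] //.
by rewrite dotNr lerNl.
Qed.

Lemma closed_cube_preimage c a : closed_cube c a = frame_coords e @^-1`
  (citv (dot c (e i0)) a `*` citv (dot c (e i1)) a `*` citv (dot c (e i2)) a).
Proof.
apply/seteqP; split => x.
  move=> /closed_cubeP H.
  have K i : dot x (e i) \in `[dot c (e i) - a / 2, dot c (e i) + a / 2].
    by rewrite -ler_norm_itv -dotBl; exact: H.
  by split; [split|]; exact: K.
move=> [[h0 h1] h2]; apply/closed_cubeP; apply: ord3P; by rewrite dotBl ler_norm_itv.
Qed.

Lemma fin_meas_oitv p a : fin_meas (@lebesgue_measure R) (oitv p a).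
Proof. exact: fin_meas_oo. Qed.

Lemma lebesgue_oitv p a : 0 <= a -> (@lebesgue_measure R) (oitv p a) = a%:E.
Proof. by move=> a0; rewrite lebesgue_measure_oo; [congr EFin; lra|lra]. Qed.

Lemma lebesgue_citv p a : 0 <= a -> (@lebesgue_measure R) (citv p a) = a%:E.
Proof.
move=> a0; apply: (etrans (lebesgue_measure_itv `[p - a / 2, p + a / 2])).
rewrite /= lte_fin; case: ltP => h; first by rewrite -EFinB; congr EFin; lra.
by congr EFin; lra.
Qed.

Lemma measurable_oitv3 p q r a b d :
  measurable (oitv p a `*` oitv q b `*` oitv r d).
Proof. by do 2?apply: measurableX; exact: measurable_itv. Qed.

Lemma measurable_citv3 p q r a :
  measurable (citv p a `*` citv q a `*` citv r a).
Proof. by do 2?apply: measurableX; exact: measurable_itv. Qed.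

Lemma mu3_oitv3 p q r a : 0 <= a ->
  mu (oitv p a `*` oitv q a `*` oitv r a) = (a ^+ 3)%:E.
Proof.
move=> a0; rewrite mu3_box; try exact: measurable_itv.
by rewrite !lebesgue_oitv// -!EFinM !exprS expr0 mulr1 mulrA.
Qed.

Lemma mu3_citv3 p q r a : 0 <= a ->
  mu (citv p a `*` citv q a `*` citv r a) = (a ^+ 3)%:E.
Proof.
move=> a0; rewrite mu3_box; try exact: measurable_itv.
by rewrite !lebesgue_citv// -!EFinM !exprS expr0 mulr1 mulrA.
Qed.

Lemma measurable_open_cube c a : measurable (open_cube e c a : set V3).
Proof.
rewrite open_cube_preimage -[X in measurable X]setTI.
by apply: measurable_frame_coords => //; exact: measurable_oitv3.
Qed.

Lemma measurable_closed_cube c a : measurable (closed_cube c a).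
Proof.
rewrite closed_cube_preimage -[X in measurable X]setTI.
by apply: measurable_frame_coords => //; exact: measurable_citv3.
Qed.

Lemma mu3_open_cube c a : 0 <= a -> mu (open_cube e c a) = (a ^+ 3)%:E.
Proof.
move=> a0; rewrite open_cube_preimage.
by apply: (etrans (mu3_frame_coords oe _)); [exact: measurable_oitv3|exact: mu3_oitv3].
Qed.

Lemma mu3_closed_cube c a : 0 <= a -> mu (closed_cube c a) = (a ^+ 3)%:E.
Proof.
move=> a0; rewrite closed_cube_preimage.
by apply: (etrans (mu3_frame_coords oe _)); [exact: measurable_citv3|exact: mu3_citv3].
Qed.

Lemma open_cube_closed c a : open_cube e c a `<=` closed_cube c a.
Proof. by move=> x /open_cubeP H g; exact: ltW. Qed.

Lemma fin_meas_open_cube c a : 0 <= a -> fin_meas mu (open_cube e c a).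
Proof.
move=> a0; split; first exact: measurable_open_cube.
by apply: (@le_lt_trans _ _ (a ^+ 3)%:E); rewrite ?ltry// -(mu3_open_cube c a0).
Qed.

Lemma fin_meas_closed_cube c a : 0 <= a -> fin_meas mu (closed_cube c a).
Proof.
move=> a0; split; first exact: measurable_closed_cube.
by apply: (@le_lt_trans _ _ (a ^+ 3)%:E); rewrite ?ltry// -(mu3_closed_cube c a0).
Qed.

Lemma closed_cube_boundary_null c a : 0 <= a ->
  mu (closed_cube c a `\` open_cube e c a) = 0%E.
Proof.
move=> a0; have [mC fC] := fin_meas_closed_cube c a0.
have mO := measurable_open_cube c a.
have := measureD mC mO fC; rewrite (setIidr (@open_cube_closed c a)) => E.
apply: (etrans E).
change (mu (closed_cube c a) - mu (open_cube e c a) = 0)%E.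
by rewrite mu3_closed_cube// mu3_open_cube// subee.
Qed.

Lemma measurable_attached_cube c a w : measurable (attached_cube e s c a w : set V3).
Proof. by elim: w c a => [|g w IH] c a /=; [exact: measurable_open_cube|exact: IH]. Qed.

Lemma measurable_tower c a f : measurable (tower c a f).
Proof.
rewrite /tower bigcup_mkcond; apply: countable_bigcupT_measurable.
  exact: countableP.
by move=> w; case: ifP => _; [exact: measurable_attached_cube|exact: measurable0].
Qed.

Lemma tower_sub_closed_cube c a f : 0 < a ->
  tower c a f `<=` closed_cube c (3 / 2 * a).
Proof.
move=> a0 x /(tower_box a0)[H _] g; have := H g; lra.
Qed.

Lemma fin_meas_tower c a f : 0 < a -> fin_meas mu (tower c a f).
Proof.
move=> a0; split; first exact: measurable_tower.
have a1 : 0 <= 3 / 2 * a by lra.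
have [mC fC] := fin_meas_closed_cube c a1.
apply: le_lt_trans fC; apply: le_measure; rewrite ?inE//.
  exact: measurable_tower.
exact: tower_sub_closed_cube.
Qed.

Lemma attached_cube_affine c a w (k : R) (b : R * R * R) x : 0 < k ->
  attached_cube e s (k *: c + b) (k * a) w (k *: x + b) <->
  attached_cube e s c a w x.
Proof.
move=> k0; elim: w c a => [|g w IH] c a /=.
  rewrite /open_cube /=; split=> H i; have := H i.
    rewrite opprD addrACA subrr addr0 -scalerBr dotZl normrM gtr0_norm//.
    by rewrite -mulrA ltr_pM2l.
  rewrite opprD addrACA subrr addr0 -scalerBr dotZl normrM gtr0_norm//.
  by rewrite -mulrA ltr_pM2l.
rewrite -IH (mulrCA k s a).
have -> // : face_centre e (k *: c + b) (k * a) g + (s * (k * a) / 2) *: normal e g =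
  k *: (face_centre e c a g + (s * a / 2) *: normal e g) + b.
rewrite /face_centre -!addrA -!(scalerDl (normal e g)) scalerDr scalerA -addrA; congr (_ + _).
by rewrite [RHS]addrC; congr (_ + _ *: _); field.
Qed.

Lemma tower_affine c a f : 0 < a ->
  tower c a f = affine3 a^-1 (- (a^-1 *: c)) @^-1` tower 0 1 f.
Proof.
move=> a0; apply/seteqP; split => x /=.
  move=> [w pw xw]; exists w => //=.
  apply/(@attached_cube_affine _ _ _ a c _ a0); rewrite scaler0 add0r mulr1.
  by rewrite scalerDr scalerN !scalerA divff ?gt_eqF// !scale1r addrNK.
move=> [w pw xw]; exists w => //=.
move/(@attached_cube_affine _ _ _ a c _ a0) : xw; rewrite scaler0 add0r mulr1.
by rewrite scalerDr scalerN !scalerA divff ?gt_eqF// !scale1r addrNK.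
Qed.

Lemma inter3_tower t c a f : 0 < t -> 0 < a ->
  inter3 t (tower c a f) (tower c a f) =
  a ^+ 3 * inter3 (t / a ^+ 2) (tower 0 1 f) (tower 0 1 f).
Proof.
move=> t0 a0; rewrite (tower_affine c f a0) inter3_scale ?invr_gt0//;
  try exact: fin_meas_tower.
by rewrite !exprVn invrK (mulrC _ t).
Qed.

End Geometry.

(** * A renewal equation *)

Section Renewal.
Variable R : realType.

Lemma pow5_small (eps : R) : 0 < eps -> exists n : nat, 5 ^- n < eps.
Proof.
move=> eps0; exists (Num.truncn eps^-1).+1; rewrite invf_plt ?posrE ?exprn_gt0//.
apply: lt_trans (truncnS_gt _) _.
by rewrite -natrX ltr_nat ltn_expl.
Qed.

(** A bound by [K * 5 ^- n] for all n is how exact equalities are obtained from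
   generation-by-generation estimates. *)
Lemma le0_pow5 (x K : R) : (forall n : nat, x <= K * 5 ^- n) -> x <= 0.
Proof.
move=> H; rewrite leNgt; apply/negP => x0.
have K0 : 0 < K by have := H 0%N; rewrite expr0 invr1 mulr1; apply: lt_le_trans.
have [n hn] := @pow5_small (x / K) (divr_gt0 x0 K0).
have := H n; rewrite leNgt => /negP; apply.
by rewrite mulrC -ltr_pdivlMr.
Qed.

Lemma expR_half_ln25 : expR (ln 25 / 2) = 5 :> R.
Proof.
have -> : (25 : R) = 5 ^+ 2 by rewrite -natrX.
have -> : ln (5 ^+ 2) / 2 = ln 5 :> R by rewrite lnXn//; field.
by rewrite lnK// posrE.
Qed.

Section QuasiPeriodic.
Variables (v : R -> R) (K : R).
Local Notation l := (ln (25 : R)).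
Hypothesis cv : continuous v.
Hypothesis vl : forall y, `|v y - v (y + l)| <= K * expR (y / 2).

Let K_ge0 : 0 <= K.
Proof. by have := le_trans (normr_ge0 _) (vl 0); rewrite pmulr_lge0 ?expR_gt0. Qed.

(** Going left by n periods makes the defect [K * expR (y / 2)] smaller by the
   factor 5 ^ n, since expR (l / 2) = 5. *)
Let w (n : nat) y := v (y - n%:R * l).
Let err (n : nat) y := K * expR (y / 2) * 5 ^- n.

Let expR_shift n (y : R) : expR ((y - n%:R * l) / 2) = expR (y / 2) * 5 ^- n.
Proof.
have -> : (y - n%:R * l) / 2 = y / 2 - n%:R * (l / 2) by ring.
by rewrite expRD expRN expRM_natl expR_half_ln25.
Qed.

Let w_step n y : `|w n y - w n.+1 y| <= err n.+1 y.
Proof.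
have := vl (y - n.+1%:R * l); rewrite expR_shift mulrA distrC.
congr (`|_ - _| <= _); rewrite /w //; congr v.
by rewrite -natr1; ring.
Qed.

Let err_step n y : err n.+1 y = err n y / 5.
Proof. by rewrite /err exprS invfM; ring. Qed.

Let err_ge0 n y : 0 <= err n y.
Proof. by rewrite /err mulr_ge0 ?invr_ge0 ?exprn_ge0// mulr_ge0// expR_ge0. Qed.

(** The intervals [w n - err n, w n + err n] are nested, because
   err n.+1 + err n.+1 <= err n: the limit of the w n can be taken as a supremum
   of left ends. *)
Let lo_nd n k y : w n y - err n y <= w (n + k) y - err (n + k) y.
Proof.
elim: k => [|k IH]; first by rewrite addn0.
apply: le_trans IH _; rewrite addnS err_step.
have := w_step (n + k) y; rewrite err_step ler_norml => /andP[h1 h2].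
by have := err_ge0 (n + k) y; lra.
Qed.

Let hi_ni n k y : w (n + k) y + err (n + k) y <= w n y + err n y.
Proof.
elim: k => [|k IH]; first by rewrite addn0.
apply: le_trans IH; rewrite addnS err_step.
have := w_step (n + k) y; rewrite err_step ler_norml => /andP[h1 h2].
by have := err_ge0 (n + k) y; lra.
Qed.

Let lo_hi n m y : w n y - err n y <= w m y + err m y.
Proof.
apply: le_trans (lo_nd n m y) _; rewrite addnC; apply: le_trans _ (hi_ni m n y).
by have := err_ge0 (m + n) y; lra.
Qed.

Let q y := sup [set w n y - err n y | n in [set: nat]].

Let q_close n y : `|w n y - q y| <= err n y.
Proof.
have nonempty : [set w n y - err n y | n in [set: nat]] !=set0.
  by exists (w 0 y - err 0 y); exists 0%N.
rewrite ler_norml; apply/andP; split.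
  suff : q y <= w n y + err n y by lra.
  by apply: ge_sup => // _ [m _ <-]; exact: lo_hi.
suff : w n y - err n y <= q y by lra.
apply: sup_ubound; last by exists n.
by exists (w 0 y + err 0 y) => _ [m _ <-].
Qed.

Let q_periodic y : q (y + l) = q y.
Proof.
apply/eqP; rewrite -subr_eq0 -normr_le0.
apply: (@le0_pow5 _ (K * expR ((y + l) / 2) + K * expR (y / 2))) => n.
have h1 := q_close n.+1 (y + l); have h2 := q_close n y.
have E : w n.+1 (y + l) = w n y.
  by rewrite /w; congr v; rewrite -natr1; ring.
rewrite E in h1.
have -> : q (y + l) - q y = (w n y - q y) - (w n y - q (y + l)) by ring.
apply: le_trans (ler_normB _ _) _.
rewrite mulrDl addrC; apply: lerD h2.
apply: le_trans h1 _; rewrite err_step -/(err n _).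
by have := err_ge0 n (y + l); rewrite /err; lra.
Qed.

Let cw n : continuous (w n).
Proof.
move=> y; apply: continuous_comp; last exact: cv.
by apply: cvgB; [exact: cvg_id|exact: cvg_cst].
Qed.

Let q_continuous : continuous q.
Proof.
move=> y; apply/cvgrPdist_lt => eps eps0.
pose E := K * expR ((y + 1) / 2) + 1.
have E0 : 0 < E by rewrite ltr_wpDl// mulr_ge0// expR_ge0.
have e3 : 0 < eps / 3 by rewrite divr_gt0.
have [n hn] := @pow5_small (eps / 3 / E) (divr_gt0 e3 E0).
have e_small z : z <= y + 1 -> err n z < eps / 3.
  move=> zy; rewrite /err; apply: (@le_lt_trans _ _ (E * 5 ^- n)); last first.
    by rewrite mulrC -ltr_pdivlMr.
  rewrite ler_wpM2r ?invr_ge0 ?exprn_ge0//.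
  apply: (@le_trans _ _ (K * expR ((y + 1) / 2))); last by rewrite /E lerDl.
  by rewrite ler_wpM2l// ler_expR ler_pM2r ?invr_gt0.
have /cvgrPdist_lt /(_ _ e3) wy := @cw n y.
near=> z.
have zy : z <= y + 1.
  have : `|y - z| < 1 by near: z; exact: (nbhsx_ballx y 1 ltr01).
  by rewrite ltr_norml => /andP[]; lra.
have wz : `|w n y - w n z| < eps / 3 by near: z.
have h1 := q_close n y; have h2 := q_close n z.
have e1 : err n y < eps / 3 by apply: e_small; lra.
have e2 := e_small z zy.
have -> : q y - q z = (w n y - w n z) - (w n y - q y) + (w n z - q z) by ring.
apply: (le_lt_trans (ler_normD _ _)); apply: (le_lt_trans (lerD (ler_normB _ _) (lexx _))).
lra.
Unshelve. all: by end_near.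
Qed.

(** A function that is periodic up to an error decaying at -oo is asymptotic at -oo
   to a unique exactly periodic function, the limit of its translates by whole
   periods to the left. The convergence is uniform on half-lines ]-oo, y],
   whence the continuity. *)
Lemma quasi_periodic_limit : exists q : R -> R,
  [/\ continuous q, (forall y, q (y + l) = q y) &
      forall y, `|v y - q y| <= K * expR (y / 2)].
Proof.
exists q; split=> // y; have := q_close 0 y.
by rewrite /w /err mul0r subr0 expr0 invr1 mulr1.
Qed.

End QuasiPeriodic.

(** The three explicit terms solve the equation with source a0 - b0 sqrt t + c0 t:
   a constant A needs A = A / 25 + a0, a multiple B sqrt t needs
   B = B / 5 - b0, and t log t gains t ln 25 from t to 25 t, at equal weight, which
   absorbs c0 t. Their difference with T, divided by t, is quasi-periodic in
   log t. *)
Lemma renewal (T : R -> R) (a0 b0 c0 C : R) :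
  (forall t, 0 < t ->
    `|T t - (T (25 * t) / 25 + a0 - b0 * Num.sqrt t + c0 * t)| <= C * (t * Num.sqrt t)) ->
  (forall t, 0 < t -> {for t, continuous T}) ->
  exists q : R -> R, [/\ continuous q, (forall y, q (y + ln 25) = q y) &
    forall t, 0 < t ->
    `|T t - (25 / 24 * a0 - 5 / 4 * b0 * Num.sqrt t - c0 / ln 25 * t * ln t
      + q (ln t) * t)| <= C * (t * Num.sqrt t)].
Proof.
move=> HT cT.
have ln25 : 0 < ln 25 :> R by rewrite ln_gt0// ltr1n.
pose r (y : R) := expR (y / 2).
have r0 y : 0 < r y by exact: expR_gt0.
have rr y : expR y = r y ^+ 2 by rewrite /r -expRM_natl; congr expR; field.
pose v (y : R) := (T (expR y) - 25 / 24 * a0) / expR y + 5 / 4 * b0 / r y + c0 / ln 25 * y.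
have cv : continuous v.
  move=> y; rewrite /v.
  have cr : {for y, continuous r}.
    apply: continuous_comp; last exact: continuous_expR.
    by apply: cvgMl; exact: cvg_id.
  apply: cvgD; first apply: cvgD.
  - apply: cvgM.
      apply: cvgB; last exact: cvg_cst.
      by apply: continuous_comp; [exact: continuous_expR|apply: cT; exact: expR_gt0].
    by apply: cvgV; [rewrite gt_eqF ?expR_gt0|exact: continuous_expR].
  - by apply: cvgMr; apply: cvgV; [rewrite gt_eqF|exact: cr].
  - by apply: cvgMr; exact: cvg_id.
have sq y : Num.sqrt (expR y) = r y by rewrite rr sqrtr_sqr gtr0_norm.
have vl y : `|v y - v (y + ln 25)| <= C * expR (y / 2).
  have e25 : expR (y + ln 25) = 25 * expR y by rewrite expRD lnK ?posrE// mulrC.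
  have r5 : r (y + ln 25) = 5 * r y.
    by rewrite /r mulrDl expRD expR_half_ln25 mulrC.
  have := HT (expR y) (expR_gt0 y); rewrite sq -/(r y).
  have e0 := expR_gt0 y.
  have -> : v y - v (y + ln 25) = (T (expR y) -
      (T (25 * expR y) / 25 + a0 - b0 * r y + c0 * expR y)) / expR y.
    rewrite /v e25 r5 rr.
    have ry := r0 y; have : ln 25 != 0 :> R by rewrite gt_eqF.
    move: (ln 25) (r y) ry (T _) (T _) => L s s0 T1 T2 L0.
    by field; rewrite L0 gt_eqF.
  move=> h; rewrite normrM normfV (gtr0_norm e0) ler_pdivrMr//.
  by apply: le_trans h _; rewrite -mulrA (mulrC (r y)).
have [q [cq pq q_close]] := quasi_periodic_limit cv vl.
exists q; split=> // t t0.
have tE : t = expR (ln t) by rewrite lnK.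
have := q_close (ln t); rewrite -/(r _).
set y := ln t in tE *.
have ry := r0 y; have st : Num.sqrt t = r y by rewrite tE sq.
rewrite st.
have -> : T t - (25 / 24 * a0 - 5 / 4 * b0 * r y - c0 / ln 25 * t * y + q y * t)
   = (v y - q y) * t.
  rewrite /v -tE; have tr : t = r y ^+ 2 by rewrite -rr.
  have L0 : ln 25 != 0 :> R by rewrite gt_eqF.
  move: (T t) (q y) => T1 q1; rewrite tr.
  clear tE st tr; move: (y) (ln 25) L0 (r y) ry => z L L0 s s0.
  by field; rewrite L0 gt_eqF.
move=> h; rewrite normrM (gtr0_norm t0).
have -> : C * (t * r y) = C * r y * t by ring.
by rewrite ler_pM2r.
Qed.

End Renewal.

(** * Errors of order 3/2 *)

Section SmallTime.
Variable R : realType.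
Implicit Types (E F B : R -> R).

(** A bound on the whole of ]0, 1], not only near 0, so that finite sums and
   products with bounded functions need no choice of neighbourhood. *)
Definition negligible32 E := exists2 C : R, 0 <= C &
  forall t, 0 < t -> t <= 1 -> `|E t| <= C * (t * Num.sqrt t).

Lemma negligible32_ext E F : negligible32 F ->
  (forall t, 0 < t -> t <= 1 -> E t = F t) -> negligible32 E.
Proof. by move=> [C C0 H] EF; exists C => // t t0 t1; rewrite EF// H. Qed.

Lemma tsqrt_ge0 (t : R) : 0 < t -> 0 <= t * Num.sqrt t.
Proof. by move=> t0; rewrite mulr_ge0 ?sqrtr_ge0// ltW. Qed.

Lemma negligible32_0 : negligible32 (fun _ => 0).
Proof. by exists 0 => // t t0 _; rewrite normr0 mul0r. Qed.

Lemma negligible32D E F : negligible32 E -> negligible32 F ->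
  negligible32 (fun t => E t + F t).
Proof.
move=> [C C0 HE] [D D0 HF]; exists (C + D); first exact: addr_ge0.
move=> t t0 t1; apply: le_trans (ler_normD _ _) _.
by rewrite mulrDl lerD ?HE ?HF.
Qed.

Lemma negligible32M E B (K : R) : negligible32 E ->
  (forall t, 0 < t -> t <= 1 -> `|B t| <= K) -> negligible32 (fun t => B t * E t).
Proof.
move=> [C C0 HE] HB.
have K0 : 0 <= K by apply: le_trans (HB 1 ltr01 (lexx _)).
exists (K * C); first exact: mulr_ge0.
move=> t t0 t1; rewrite normrM -mulrA.
by apply: ler_pM => //; [exact: HB|exact: HE].
Qed.

Lemma negligible32Z E (k : R) : negligible32 E -> negligible32 (fun t => k * E t).
Proof. by move=> nE; exact: (@negligible32M E (fun _ => k) `|k|). Qed.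

Lemma negligible32_sum (I : finType) (P : pred I) (E : I -> R -> R) :
  (forall i, P i -> negligible32 (E i)) -> negligible32 (fun t => \sum_(i | P i) E i t).
Proof.
move=> nE; pose Ei i := if P i then E i else fun _ => 0.
have nEi i : negligible32 (Ei i).
  by rewrite /Ei; case: ifPn => [/nE|_] //; exact: negligible32_0.
have sE t : \sum_(i | P i) E i t = \sum_(i <- index_enum I) Ei i t.
  by rewrite big_mkcond; apply: eq_bigr => i _; rewrite /Ei; case: ifP.
apply: (@negligible32_ext _ (fun t => \sum_(i <- index_enum I) Ei i t)) => //.
elim: (index_enum I) => [|i r IH].
  by apply: (negligible32_ext negligible32_0) => t _ _; rewrite big_nil.
by apply: (negligible32_ext (negligible32D (nEi i) IH)) => t _ _; rewrite big_cons.
Qed.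

Lemma negligible32_sqr E : (exists2 C : R, 0 <= C &
  forall t, 0 < t -> t <= 1 -> `|E t| <= C * t ^+ 2) -> negligible32 E.
Proof.
move=> [C C0 H]; exists C => // t t0 t1; apply: le_trans (H t t0 t1) _.
have s1 : Num.sqrt t <= 1 by rewrite -sqrtr1 ler_sqrt.
have st : t <= Num.sqrt t.
  have e : t = Num.sqrt t * Num.sqrt t by rewrite -expr2 sqr_sqrtr// ltW.
  by rewrite [leLHS]e ler_piMr ?sqrtr_ge0.
by rewrite ler_wpM2l// expr2 ler_wpM2l// ltW.
Qed.

Lemma negligible32_ge0 E (C : R) : 0 <= C -> (forall t, 0 < t -> 0 <= E t) ->
  (forall t, 0 < t -> E t <= C * (t * Num.sqrt t)) -> negligible32 E.
Proof. by move=> C0 E0 H; exists C => // t t0 t1; rewrite ger0_norm ?E0 ?H. Qed.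

End SmallTime.

Section FiniteUnions.
Context d (T : measurableType d) (R : realType).
Variable m : {sigma_finite_measure set T -> \bar R}.
Variables (I : finType) (F : I -> set T).
Hypothesis fF : forall i, fin_meas m (F i).
Hypothesis dF : forall i j, i != j -> F i `&` F j = set0.

Let fin_meas_big (P : pred I) r : fin_meas m (\big[setU/set0]_(i <- r | P i) F i).
Proof.
elim: r => [|i r IH].
  by rewrite big_nil; split; [exact: measurable0|rewrite measure0 ltry].
by rewrite big_cons; case: ifP => // _; exact: fin_measU.
Qed.

Lemma fin_meas_bigU (P : pred I) : fin_meas m (\big[setU/set0]_(i | P i) F i).
Proof. exact: fin_meas_big. Qed.

Lemma interaction_bigUl (K : T * T -> R) (P : pred I) B :
  bounded_kernel K -> fin_meas m B ->
  interaction m K (\big[setU/set0]_(i | P i) F i) B =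
  \sum_(i | P i) interaction m K (F i) B.
Proof.
move=> gK fB; have := index_enum_uniq I.
elim: (index_enum I) => [|i r IH]; rewrite ?big_nil.
  move=> _; apply: interaction_null => //.
    by split; [exact: measurable0|rewrite measure0 ltry].
move=> /= /andP[ir ur]; rewrite !big_cons; case: ifP => // Pi; last exact: IH.
rewrite interactionUl ?IH//.
rewrite big_distrr /=.
elim: r ir {IH ur} => [|j r IH]; first by rewrite big_nil.
rewrite inE negb_or => /andP[ij ir]; rewrite big_cons.
by case: ifP => // _; rewrite ?dF// ?set0U IH.
Qed.

Lemma interaction_bigU (K : T * T -> R) (P : pred I) :
  bounded_kernel K -> (forall x y, K (x, y) = K (y, x)) ->
  interaction m K (\big[setU/set0]_(i | P i) F i) (\big[setU/set0]_(i | P i) F i) =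
  \sum_(i | P i) \sum_(j | P j) interaction m K (F i) (F j).
Proof.
move=> gK Ks; have fU := fin_meas_bigU P.
rewrite interaction_bigUl//; apply: eq_bigr => i _.
rewrite (interaction_sym m gK Ks (fF i).1 fU.1) interaction_bigUl//.
by apply: eq_bigr => j _; exact: (interaction_sym m gK Ks (fF j).1 (fF i).1).
Qed.

End FiniteUnions.

(** * Heat exchanged between cubes *)

Section CubeInteractions.
Variable R : realType.
Local Notation M := (measurableTypeR R).
Local Notation V3 := (M * M * M)%type.
Local Notation mu := (@mu3 R).
Local Notation leb := (@lebesgue_measure R).
Local Notation S t := (Num.sqrt (t / pi)).
Local Notation s := (5^-1 : R).
Variable e : 'I_3 -> R * R * R.
Hypothesis oe : orthonormal_frame e.
Implicit Types (c x y : R * R * R) (a t p : R) (f g h : face).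

Lemma sqr_face_coord_dist c g x y :
  (face_coord e c g x - face_coord e c g y) ^+ 2 <= dot (x - y) (x - y).
Proof.
have -> : face_coord e c g x - face_coord e c g y = dot (x - y) (normal e g).
  rewrite /face_coord -dotBl; congr (dot _ _).
  by rewrite opprB addrA addrNK.
rewrite -(dot_frame_coords (x - y) (x - y) oe) /frame_coords.
set z := x - y.
have H i : (dot z (e i)) ^+ 2 <=
    dot z (e i0) * dot z (e i0) + dot z (e i1) * dot z (e i1) + dot z (e i2) * dot z (e i2).
  have q (u : R) : 0 <= u * u by rewrite -expr2 sqr_ge0.
  by have := q (dot z (e i0)); have := q (dot z (e i1)); have := q (dot z (e i2));
    elim/ord3P: i; rewrite expr2; lra.
by case: g => i []; rewrite /normal /= ?dotNr ?sqrrN; exact: H.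
Qed.

Lemma heat3E t x y : 0 < t -> heat3 t (x, y) =
  (Num.sqrt (4 * pi * t))^-1 ^+ 3 * expR (- (dot (x - y) (x - y) / (4 * t))).
Proof.
move=> t0; rewrite heat3_heat1// /heat1 /=.
set q := (Num.sqrt _)^-1.
have -> : - (dot (x - y) (x - y) / (4 * t)) = - ((x.1.1 - y.1.1) ^+ 2 / (4 * t)) +
   - ((x.1.2 - y.1.2) ^+ 2 / (4 * t)) + - ((x.2 - y.2) ^+ 2 / (4 * t)).
  by rewrite /dot /=; field; rewrite gt_eqF.
by rewrite !expRD; ring.
Qed.

Lemma heat3_far t x y (delta : R) : 0 < t -> 0 < delta ->
  delta ^+ 2 <= dot (x - y) (x - y) ->
  heat3 t (x, y) <= (12 / delta ^+ 2) ^+ 3 * (t * Num.sqrt t).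
Proof.
move=> t0 d0 dxy; have s0 : 0 < Num.sqrt t by rewrite sqrtr_gt0.
have d20 : 0 < delta ^+ 2 by rewrite exprn_gt0.
rewrite heat3E//.
have q1 : (Num.sqrt (4 * pi * t))^-1 <= (Num.sqrt t)^-1.
  have f0 := four_pi_gt0 t0.
  rewrite lef_pV2 ?posrE ?sqrtr_gt0// ler_sqrt ?(ltW f0)//.
  by rewrite ler_peMl ?(ltW t0)//; have := pi_ge2 R; lra.
have E : expR (- (dot (x - y) (x - y) / (4 * t))) <= (12 / delta ^+ 2) ^+ 3 * t ^+ 3.
  apply: (@le_trans _ _ (expR (- (delta ^+ 2 / 4 / t)))).
    rewrite ler_expR lerN2 -mulrA -invfM ler_pM2r//.
    by rewrite invr_gt0 mulr_gt0.
  apply: le_trans (@expRN_le_pow R 2 _ _ _ t0) _; first by rewrite divr_gt0.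
  rewrite ler_pM2r ?exprn_gt0// le_eqVlt; apply/orP; left; apply/eqP.
  by congr (_ ^+ _); field; rewrite gt_eqF.
apply: (@le_trans _ _ ((Num.sqrt t)^-1 ^+ 3 * ((12 / delta ^+ 2) ^+ 3 * t ^+ 3))).
  apply: ler_pM => //; rewrite ?exprn_ge0 ?invr_ge0 ?sqrtr_ge0 ?expR_ge0//.
  by rewrite lerXn2r ?nnegrE ?invr_ge0 ?sqrtr_ge0.
have te : t = Num.sqrt t ^+ 2 by rewrite sqr_sqrtr// ltW.
rewrite le_eqVlt; apply/orP; left; apply/eqP.
move: (12 / _) => D; rewrite [in t ^+ 3]te [in RHS]te sqrtr_sqr (gtr0_norm s0).
by field; rewrite gt_eqF.
Qed.

Lemma inter3_ge0 t (A B : set V3) : 0 < t -> 0 <= inter3 t A B.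
Proof. by move=> t0; apply: interaction_ge0; exact: heat3_bounded. Qed.

(** A slab orthogonal to a normal lies between A and B, hence their Euclidean
   distance is at least [delta] and the kernel is small there. *)
Lemma inter3_separated (A B : set V3) c g (delta : R) : 0 < delta ->
  fin_meas mu A -> fin_meas mu B ->
  (forall x y, A x -> B y -> delta <= face_coord e c g x - face_coord e c g y) ->
  negligible32 (fun t => inter3 t A B).
Proof.
move=> d0 fA fB H.
apply: (@negligible32_ge0 _ _ ((12 / delta ^+ 2) ^+ 3 * (fine (mu A) * fine (mu B)))).
- by rewrite mulr_ge0 ?exprn_ge0 ?divr_ge0 ?sqr_ge0// mulr_ge0 ?fine_ge0.
- by move=> t t0; exact: inter3_ge0.
- move=> t t0; rewrite mulrAC.
  apply: interaction_le => //; first exact: heat3_bounded.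
  move=> x y Ax By; apply: heat3_far => //.
  apply: le_trans (sqr_face_coord_dist c g x y).
  by rewrite lerXn2r ?nnegrE ?H//; [exact: ltW|rewrite (le_trans _ (H x y Ax By))// ltW].
Qed.

Lemma inter3_cubes t c c' a a' : 0 < t -> 0 <= a -> 0 <= a' ->
  inter3 t (open_cube e c a) (open_cube e c' a') =
  inter1 t (oitv (dot c (e i0)) a) (oitv (dot c' (e i0)) a') *
  inter1 t (oitv (dot c (e i1)) a) (oitv (dot c' (e i1)) a') *
  inter1 t (oitv (dot c (e i2)) a) (oitv (dot c' (e i2)) a').
Proof.
move=> t0 a0 a'0; have fo p b : fin_meas leb (oitv p b) by exact: fin_meas_oitv.
have f3 p q r b : 0 <= b -> fin_meas mu (oitv p b `*` oitv q b `*` oitv r b).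
  move=> b0; split; first exact: measurable_oitv3.
  change (mu (oitv p b `*` oitv q b `*` oitv r b) < +oo)%E.
  by rewrite mu3_oitv3// ltry.
rewrite !open_cube_preimage inter3_frame_coords//; try exact: f3.
by rewrite inter3_box.
Qed.

Lemma oitvE p a : oitv p a = [set` `](p - a / 2), (p + a / 2)[].
Proof. by []. Qed.

(** In a direction parallel to the common face, the side of an attached cube lies
   well inside that of the cube that carries it. *)
Lemma side_expansion p :
  negligible32 (fun t => inter1 t (oitv p 1) (oitv p (s * 1)) - s).
Proof.
apply: negligible32_sqr.
have h1 : p - s * 1 / 2 < p + s * 1 / 2 by lra.
have h2 : 0 < (2 / 5 : R) by rewrite divr_gt0.
have [|C C0 HC] := inter1_inside_expansion h1 h2 (measurable_itv `]p - 1 / 2, p + 1 / 2[).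
  move=> x y /andP[? ?]; rewrite ltr_norml => /andP[? ?] /=.
  by rewrite in_itv /=; apply/andP; split; lra.
exists C => // t t0 t1; have := HC t t0 t1.
rewrite (inter1_sym t0)//; try exact: measurable_itv.
by rewrite (_ : p + s * 1 / 2 - (p - s * 1 / 2) = s)//; lra.
Qed.

(** In the direction normal to the common face, the two sides are adjacent
   intervals; 3/5 = 1/2 + 1/10 is the distance of the centres. *)
Lemma normal_expansion p (b : bool) :
  negligible32 (fun t => inter1 t (oitv p 1)
    (oitv (p + 3 / 5 * (if b then 1 else -1)) (s * 1)) - S t).
Proof.
apply: negligible32_sqr; case: b.
  have h1 : p - 1 / 2 < p + 1 / 2 by lra.
  have h2 : p + 1 / 2 < p + 7 / 10 by lra.
  have [C C0 HC] := inter1_adjacent_expansion h1 h2.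
  exists C => // t t0 t1; have := HC t t0 t1; rewrite !oitvE.
  rewrite (_ : p + 3 / 5 * 1 - s * 1 / 2 = p + 1 / 2); last by lra.
  by rewrite (_ : p + 3 / 5 * 1 + s * 1 / 2 = p + 7 / 10); last by lra.
have h1 : p - 7 / 10 < p - 1 / 2 by lra.
have h2 : p - 1 / 2 < p + 1 / 2 by lra.
have [C C0 HC] := inter1_adjacent_expansion h1 h2.
exists C => // t t0 t1; have := HC t t0 t1.
rewrite (inter1_sym t0); try exact: measurable_itv.
rewrite !oitvE.
rewrite (_ : p + 3 / 5 * (-1) - s * 1 / 2 = p - 7 / 10); last by lra.
by rewrite (_ : p + 3 / 5 * (-1) + s * 1 / 2 = p - 1 / 2); last by lra.
Qed.

Lemma inter1_oitv_bound t p (J : set M) : 0 < t -> measurable J ->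
  `|inter1 t (oitv p 1) J| <= 1.
Proof.
move=> t0 mJ; rewrite ger0_norm; last exact: inter1_ge0.
have h : p - 1 / 2 <= p + 1 / 2 by lra.
by apply: le_trans (inter1_le_length t0 h mJ) _; lra.
Qed.

(** [(1 - 2 * S) ^+ 3 = 1 - 6 * S + 12 * S ^+ 2 - 8 * S ^+ 3], and [S ^+ 2] is
   [t / pi]. *)
Lemma inter3_cube_self_expansion c :
  negligible32 (fun t => inter3 t (open_cube e c 1) (open_cube e c 1)
    - (1 - 6 * S t + 12 / pi * t)).
Proof.
have selfJ p : negligible32 (fun t => inter1 t (oitv p 1) (oitv p 1) - (1 - 2 * S t)).
  apply: negligible32_sqr; have h1 : p - 1 / 2 < p + 1 / 2 by lra.
  have [C C0 HC] := inter1_self_expansion h1.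
  exists C => // t t0 t1; have := HC t t0 t1; rewrite -oitvE.
  by rewrite (_ : p + 1 / 2 - (p - 1 / 2) = 1); last by lra.
have Jb p t : 0 < t -> t <= 1 -> `|inter1 t (oitv p 1) (oitv p 1)| <= 1.
  by move=> t0 t1; apply: inter1_oitv_bound => //; exact: measurable_itv.
have ub t : 0 < t -> t <= 1 -> `|1 - 2 * S t| <= 1.
  by move=> t0 t1; have /andP[? ?] := sqrt_div_pi_le1 t0 t1;
    rewrite ler_norml; apply/andP; split; lra.
have S3 : negligible32 (fun t => S t ^+ 3).
  exists 1 => // t t0 t1; rewrite mul1r ger0_norm ?exprn_ge0 ?sqrtr_ge0//.
  have p1 : 1 <= pi :> R by have := pi_ge2 R; lra.
  have tp : t / pi <= t by rewrite ler_pdivrMr ?pi_gt0// ler_peMr// ltW.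
  have tp0 : 0 <= t / pi by rewrite divr_ge0 ?pi_ge0// ltW.
  rewrite exprSr sqr_sqrtr//; apply: ler_pM => //.
  by rewrite ler_sqrt// ltW.
pose J0 t := inter1 t (oitv (dot c (e i0)) 1) (oitv (dot c (e i0)) 1).
pose J1 t := inter1 t (oitv (dot c (e i1)) 1) (oitv (dot c (e i1)) 1).
pose J2 t := inter1 t (oitv (dot c (e i2)) 1) (oitv (dot c (e i2)) 1).
pose u t := 1 - 2 * S t.
have n0 : negligible32 (fun t => (J1 t * J2 t) * (J0 t - u t)).
  apply: (@negligible32M _ _ (fun t => J1 t * J2 t) 1); first exact: selfJ.
  by move=> t t0 t1; rewrite normrM mulr_ile1 ?normr_ge0 ?Jb.
have n1 : negligible32 (fun t => (u t * J2 t) * (J1 t - u t)).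
  apply: (@negligible32M _ _ (fun t => u t * J2 t) 1); first exact: selfJ.
  by move=> t t0 t1; rewrite normrM mulr_ile1 ?normr_ge0 ?Jb ?ub.
have n2 : negligible32 (fun t => (u t * u t) * (J2 t - u t)).
  apply: (@negligible32M _ _ (fun t => u t * u t) 1); first exact: selfJ.
  by move=> t t0 t1; rewrite normrM mulr_ile1 ?normr_ge0 ?ub.
apply: (negligible32_ext (negligible32D (negligible32D n0 n1)
  (negligible32D n2 (negligible32Z (-8) S3)))) => t t0 t1.
rewrite inter3_cubes// -/(J0 t) -/(J1 t) -/(J2 t).
have -> : 12 / pi * t = 12 * (S t ^+ 2).
  rewrite sqr_sqrtr; first by rewrite -mulrA (mulrC _ t).
  by rewrite divr_ge0 ?pi_ge0// ltW.
by rewrite /u; move: (J0 t) (J1 t) (J2 t) (S t) => *; ring.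
Qed.

Lemma three_factor_expansion (K1 K2 L : R -> R) :
  negligible32 (fun t => K1 t - s) -> negligible32 (fun t => K2 t - s) ->
  negligible32 (fun t => L t - S t) ->
  (forall t, 0 < t -> `|K2 t| <= 1) -> (forall t, 0 < t -> `|L t| <= 1) ->
  negligible32 (fun t => K1 t * K2 t * L t - S t / 25).
Proof.
move=> n1 n2 n3 b2 b3.
have m1 : negligible32 (fun t => (K2 t * L t) * (K1 t - s)).
  apply: (@negligible32M _ _ (fun t => K2 t * L t) 1) => // t t0 t1.
  by rewrite normrM mulr_ile1 ?normr_ge0 ?b2 ?b3.
have m2 : negligible32 (fun t => (s * L t) * (K2 t - s)).
  apply: (@negligible32M _ _ (fun t => s * L t) 1) => // t t0 t1.
  rewrite normrM mulr_ile1 ?normr_ge0 ?b3//.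
  by rewrite ger0_norm ?invr_ge0// invf_le1// ler1n.
apply: (negligible32_ext (negligible32D (negligible32D m1 m2) (negligible32Z (s * s) n3))).
by move=> t t0 t1; field.
Qed.

Lemma dot_child c g i : dot (child e c 1 g) (e i) =
  dot c (e i) + 3 / 5 * (if g.1 == i then if g.2 then 1 else -1 else 0).
Proof.
rewrite childE dotDl dotZl mulr1; congr (_ + _ * _).
case: g => j [] /=; rewrite /normal /= ?dotNl oe; case: eqVneq => _ //.
by rewrite oppr0.
Qed.

(** Two factors [1 / 5] from the sides of the common square, and one factor [S t]
   from the normal direction. *)
Lemma inter3_cube_child_expansion c g :
  negligible32 (fun t => inter3 t (open_cube e c 1)
    (open_cube e (child e c 1 g) (s * 1)) - S t / 25).
Proof.
have bnd p q : forall t, 0 < t -> `|inter1 t (oitv p 1) (oitv q (s * 1))| <= 1.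
  by move=> t t0; apply: inter1_oitv_bound => //; exact: measurable_itv.
case: g => i b; elim/ord3P: i.
- apply: (negligible32_ext (three_factor_expansion (side_expansion (dot c (e i1)))
    (side_expansion (dot c (e i2))) (normal_expansion (dot c (e i0)) b) (bnd _ _) (bnd _ _))).
  move=> t t0 t1; rewrite inter3_cubes// !dot_child /= mulr0 !addr0.
  by congr (_ - _); rewrite -mulrA mulrC.
- apply: (negligible32_ext (three_factor_expansion (side_expansion (dot c (e i0)))
    (side_expansion (dot c (e i2))) (normal_expansion (dot c (e i1)) b) (bnd _ _) (bnd _ _))).
  move=> t t0 t1; rewrite inter3_cubes// !dot_child /= mulr0 !addr0.
  by congr (_ - _); rewrite mulrAC.
- apply: (negligible32_ext (three_factor_expansion (side_expansion (dot c (e i0)))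
    (side_expansion (dot c (e i1))) (normal_expansion (dot c (e i2)) b) (bnd _ _) (bnd _ _))).
  by move=> t t0 t1; rewrite inter3_cubes// !dot_child /= mulr0 !addr0.
Qed.

End CubeInteractions.

(** * A cube with branches *)

Section Assembly.
Variable R : realType.
Local Notation M := (measurableTypeR R).
Local Notation V3 := (M * M * M)%type.
Local Notation mu := (@mu3 R).
Local Notation S t := (Num.sqrt (t / pi)).
Local Notation s := (5^-1 : R).
Variable e : 'I_3 -> R * R * R.
Hypothesis oe : orthonormal_frame e.
Implicit Types (c x y : R * R * R) (a t p : R) (f g h : face).

Lemma inter3Ul t (A1 A2 B : set V3) : 0 < t -> fin_meas mu A1 -> fin_meas mu A2 ->
  fin_meas mu B -> A1 `&` A2 = set0 ->
  inter3 t (A1 `|` A2) B = inter3 t A1 B + inter3 t A2 B.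
Proof. by move=> t0; apply: interactionUl; exact: heat3_bounded. Qed.

Lemma inter3Ur t (A B1 B2 : set V3) : 0 < t -> fin_meas mu A -> fin_meas mu B1 ->
  fin_meas mu B2 -> B1 `&` B2 = set0 ->
  inter3 t A (B1 `|` B2) = inter3 t A B1 + inter3 t A B2.
Proof.
move=> t0; apply: interactionUr; first exact: heat3_bounded.
by move=> x y; exact: heat3_sym.
Qed.

Definition branch c g : set V3 := tower e (child e c 1 g) (s * 1) g.

Definition cube_with_branches c (P : pred face) : set V3 :=
  open_cube e c 1 `|` \big[setU/set0]_(g | P g) branch c g.

Lemma bigcup_big (P : pred face) (F : face -> set V3) :
  \bigcup_(g in [set g | P g]) F g = \big[setU/set0]_(g | P g) F g.
Proof. exact: (bigcup_pred P F). Qed.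

Lemma tower_branches c f : tower e c 1 f = cube_with_branches c (may_follow f).
Proof. by rewrite towerE bigcup_big. Qed.

Lemma attached_cubes_branches c :
  \bigcup_(w in [set w | admissible w]) attached_cube e s c 1 w
  = cube_with_branches c xpredT.
Proof.
rewrite attached_cubesE /cube_with_branches -bigcup_big; congr (_ `|` _).
by apply/seteqP; split => x [g _ xg]; exists g.
Qed.

Lemma s1_gt0 : 0 < s * 1.
Proof. by rewrite mulr1 invr_gt0. Qed.

Lemma fin_meas_branch c g : fin_meas mu (branch c g).
Proof. by apply: fin_meas_tower => //; exact: s1_gt0. Qed.

(** From [tower_box] for a tower of size 1/5 centred at distance 3/5: it stays above
   3/5 - 1/10 = 1/2 in the direction of g, and its height in other directions is
   at most (3/4)/5 = 3/20. *)
Lemma branch_coord c g x : branch c g x ->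
  1 / 2 < face_coord e c g x /\ forall h, h != g -> face_coord e c h x <= 3 / 20.
Proof.
move=> /(tower_box oe s1_gt0) [hi lo]; split.
  have gg : (g == opposite g) = false.
    by case: g {hi lo} => i [] /=; rewrite /opposite /= xpair_eqE andbF.
  by move: lo; rewrite face_coord_child// eqxx gg /= mulr1n mulr0n; lra.
move=> h hg; have := hi h; rewrite face_coord_child//.
rewrite eq_sym (negbTE hg).
by case: eqVneq => _; rewrite /= ?mulr1n ?mulr0n; lra.
Qed.

Lemma branch_separated c g h x y : g != h -> branch c g x -> branch c h y ->
  7 / 20 <= face_coord e c g x - face_coord e c g y.
Proof.
by move=> gh /branch_coord[lo _] /branch_coord[_ /(_ g gh) hi]; lra.
Qed.

Lemma branch_disjoint c g h : g != h -> branch c g `&` branch c h = set0.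
Proof.
move=> gh; apply/seteqP; split => x //= [xg xh].
by have := branch_separated gh xg xh; lra.
Qed.

Lemma cube_branch_disjoint c g : open_cube e c 1 `&` branch c g = set0.
Proof.
apply/seteqP; split => x //= [/open_cubeP xQ /branch_coord[lo _]].
by have := xQ g; lra.
Qed.

(** Beyond its first cube, a branch consists of towers of size 1/25 centred at
   height at least 3/5, which reach down by at most (3/4)/25. *)
Lemma far_from_face c g x : branch c g x -> ~ open_cube e (child e c 1 g) (s * 1) x ->
  57 / 100 <= face_coord e c g x.
Proof.
rewrite /branch towerE => -[//|[h /= gh xh]] _.
have ss : 0 < s * (s * 1) by rewrite mulr_gt0 ?s1_gt0.
have [hi _] := tower_box oe ss xh.
have := hi (opposite g); rewrite face_coord_child// face_coord_opposite oppositeK.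
rewrite (negbTE gh) face_coord_child// eqxx.
have -> : (g == opposite g) = false.
  by case: g {hi gh xh} => i [] /=; rewrite /opposite /= xpair_eqE andbF.
by case: eqVneq => _; rewrite /= ?mulr1n ?mulr0n; lra.
Qed.

Lemma inter3_cube_branch_expansion c g :
  negligible32 (fun t => inter3 t (open_cube e c 1) (branch c g) - S t / 25).
Proof.
set Q := open_cube e c 1; set Q1 := open_cube e (child e c 1 g) (s * 1).
have fQ : fin_meas mu Q by exact: fin_meas_open_cube.
have fQ1 : fin_meas mu Q1 by apply: fin_meas_open_cube => //; exact: ltW s1_gt0.
have fB := fin_meas_branch c g.
have sub : Q1 `<=` branch c g by rewrite /branch towerE => x; left.
have fD : fin_meas mu (branch c g `\` Q1).
  split; first by apply: measurableD; [case: fB|case: fQ1].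
  apply: le_lt_trans fB.2; apply: le_measure; rewrite ?inE//.
  - by apply: measurableD; [case: fB|case: fQ1].
  - by case: fB.
have far : negligible32 (fun t => inter3 t (branch c g `\` Q1) Q).
  have d0 : 0 < 7 / 100 :> R by rewrite divr_gt0.
  have sep x y : (branch c g `\` Q1) x -> Q y ->
      7 / 100 <= face_coord e c g x - face_coord e c g y.
    move=> [xB nxQ1] /open_cubeP yQ.
    by have := far_from_face xB nxQ1; have := yQ g; lra.
  exact: (inter3_separated oe d0 fD fQ sep).
apply: (negligible32_ext (negligible32D (inter3_cube_child_expansion oe c g) far)).
move=> t t0 t1; rewrite -/Q -/Q1.
rewrite (inter3_sym t0 fD.1 fQ.1).
have -> : inter3 t Q (branch c g) = inter3 t Q Q1 + inter3 t Q (branch c g `\` Q1).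
  rewrite -[in LHS](setDUK sub).
  exact: (inter3Ur t0 fQ fQ1 fD (setDIK _ _)).
by ring.
Qed.

Lemma inter3_branch t c g : 0 < t ->
  inter3 t (branch c g) (branch c g) =
  inter3 (25 * t) (tower e 0 1 g) (tower e 0 1 g) / 125.
Proof.
move=> t0; rewrite /branch inter3_tower ?s1_gt0// mulrC.
have -> : t / (s * 1) ^+ 2 = 25 * t by field.
by congr (_ * _); field.
Qed.

(** The self-similar expansion on which everything rests: see the four kinds of
   terms above. *)
Lemma cube_with_branches_expansion c (P : pred face) : negligible32 (fun t =>
  inter3 t (cube_with_branches c P) (cube_with_branches c P)
  - (1 - 6 * S t + 12 / pi * t +
     \sum_(g | P g) (2 / 25 * S t
       + inter3 (25 * t) (tower e 0 1 g) (tower e 0 1 g) / 125))).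
Proof.
set Q := open_cube e c 1; set W := \big[setU/set0]_(g | P g) branch c g.
have fQ : fin_meas mu Q by exact: fin_meas_open_cube.
have fB g := fin_meas_branch c g.
have dB g h : g != h -> branch c g `&` branch c h = set0 by exact: branch_disjoint.
have fW : fin_meas mu W by exact: fin_meas_bigU.
have dQW : Q `&` W = set0.
  by rewrite /W big_distrr /=; apply: big1 => g _; exact: cube_branch_disjoint.
have n1 := inter3_cube_self_expansion oe c; rewrite -/Q in n1.
have n2 : negligible32 (fun t => \sum_(g | P g) 2 * (inter3 t Q (branch c g) - S t / 25)).
  by apply: negligible32_sum => g _; apply: negligible32Z; exact: inter3_cube_branch_expansion.
have n3 : negligible32 (fun t => \sum_(g | P g) \sum_(h | P h && (h != g))
    inter3 t (branch c g) (branch c h)).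
  apply: negligible32_sum => g _; apply: negligible32_sum => h /andP[_ hg].
  have d0 : 0 < 7 / 20 :> R by rewrite divr_gt0.
  have gh : g != h by rewrite eq_sym.
  have sep x y : branch c g x -> branch c h y ->
    7 / 20 <= face_coord e c g x - face_coord e c g y by exact: branch_separated.
  exact: (inter3_separated oe d0 (fB g) (fB h) sep).
apply: (negligible32_ext (negligible32D n1 (negligible32D n2 n3))) => t t0 t1.
have gK := heat3_bounded t0.
have sK x y : heat3 t (x, y) = heat3 t (y, x) by exact: heat3_sym.
have fQW := fin_measU fQ fW.
have E1 : inter3 t (Q `|` W) (Q `|` W) =
    inter3 t Q Q + 2 * inter3 t Q W + inter3 t W W.
  rewrite (inter3Ul t0 fQ fW fQW dQW) (inter3Ur t0 fQ fQ fW dQW).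
  rewrite (inter3Ur t0 fW fQ fW dQW) (inter3_sym t0 fW.1 fQ.1).
  by ring.
have E2 : inter3 t Q W = \sum_(g | P g) inter3 t Q (branch c g).
  rewrite (inter3_sym t0 fQ.1 fW.1) /inter3 interaction_bigUl//.
  by apply: eq_bigr => g _; exact: (inter3_sym t0 (fB g).1 fQ.1).
have E3 : inter3 t W W = \sum_(g | P g)
    (inter3 (25 * t) (tower e 0 1 g) (tower e 0 1 g) / 125 +
     \sum_(h | P h && (h != g)) inter3 t (branch c g) (branch c h)).
  rewrite /inter3 interaction_bigU//; apply: eq_bigr => g Pg.
  by rewrite (bigD1 g)//= -/(inter3 t _ _) inter3_branch.
have E4 : \sum_(g | P g) 2 * (inter3 t Q (branch c g) - S t / 25) =
    2 * (\sum_(g | P g) inter3 t Q (branch c g)) - \sum_(g | P g) 2 / 25 * S t.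
  by rewrite mulr_sumr -sumrB; apply: eq_bigr => g _; field.
rewrite /cube_with_branches -/Q -/W E1 E2 E3 E4 !big_split /=.
by ring.
Qed.

End Assembly.

(** * The heat content of the towers *)

Section TowerHeat.
Variable R : realType.
Local Notation M := (measurableTypeR R).
Local Notation V3 := (M * M * M)%type.
Local Notation mu := (@mu3 R).
Local Notation S t := (Num.sqrt (t / pi)).
Variable e : 'I_3 -> R * R * R.
Hypothesis oe : orthonormal_frame e.
Implicit Types (c x y : R * R * R) (a t p : R) (f g h : face).

(** The sum over the six faces satisfies an equation in itself, which for a single
   tower would require congruences between the towers on different faces. *)
Definition tower_heat t : R :=
  \sum_f inter3 t (tower e 0 1 f) (tower e 0 1 f).

(** A face g grows on the towers of all faces f but [opposite g]. *)
Lemma sum_branches (X : face -> R) :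
  \sum_f \sum_(g | may_follow f g) X g = 5 * \sum_g X g.
Proof.
rewrite (exchange_big_dep xpredT)//= mulr_sumr; apply: eq_bigr => g _.
rewrite sumr_const (_ : #|_| = 5%N) ?mulr_natl//.
transitivity #|predC1 (opposite g)|; last first.
  by rewrite cardC1 card_prod card_ord card_bool.
apply: eq_card => f; rewrite !inE /may_follow; congr (~~ _).
by apply/eqP/eqP => ->; rewrite oppositeK.
Qed.

Lemma sum_face_const (x : R) : \sum_(f : face) x = 6 * x.
Proof. by rewrite sumr_const card_prod card_ord card_bool mulr_natl. Qed.

Lemma sqrt_div_pi t : 0 < t -> S t = Num.sqrt t / Num.sqrt pi.
Proof. by move=> t0; rewrite sqrtrM ?ltW// sqrtrV ?pi_ge0. Qed.

Lemma tower_heat_equation_small : negligible32 (fun t => tower_heat t -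
  (tower_heat (25 * t) / 25 + 6 - 168 / 5 / Num.sqrt pi * Num.sqrt t + 72 / pi * t)).
Proof.
have n : negligible32 (fun t => \sum_f (
    inter3 t (cube_with_branches e 0 (may_follow f)) (cube_with_branches e 0 (may_follow f))
  - (1 - 6 * S t + 12 / pi * t +
     \sum_(g | may_follow f g) (2 / 25 * S t
       + inter3 (25 * t) (tower e 0 1 g) (tower e 0 1 g) / 125)))).
  by apply: negligible32_sum => f _; exact: cube_with_branches_expansion.
apply: (negligible32_ext n) => t t0 t1.
rewrite sumrB big_split /= sum_branches !big_split /=.
rewrite !sum_face_const -mulr_suml -/(tower_heat (25 * t)).
have -> : \sum_f inter3 t (cube_with_branches e 0 (may_follow f))
    (cube_with_branches e 0 (may_follow f)) = tower_heat t.
  by apply: eq_bigr => f _; rewrite tower_branches.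
have -> : 168 / 5 / Num.sqrt pi * Num.sqrt t = 168 / 5 * S t.
  by rewrite sqrt_div_pi//; ring.
move: (tower_heat t) (tower_heat _) (S t) => A B s.
have -> : 12 / pi = pi^-1 * 12 :> R by rewrite mulrC.
have -> : 72 / pi = pi^-1 * 72 :> R by rewrite mulrC.
move: (pi^-1) => p.
by field.
Qed.

Lemma heat3_le1 t x y : 1 <= t -> heat3 t (x, y) <= 1.
Proof.
move=> t1; have t0 : 0 < t by apply: lt_le_trans t1.
rewrite heat3E//; apply: mulr_ile1; rewrite ?expR_ge0 ?exprn_ge0 ?invr_ge0 ?sqrtr_ge0//.
  apply: exprn_ile1; rewrite ?invr_ge0 ?sqrtr_ge0//.
  have f0 := four_pi_gt0 t0.
  rewrite invf_le1 ?sqrtr_gt0// -[leLHS]sqrtr1 ler_sqrt ?(ltW f0)//.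
  have : 1 * 1 <= 4 * pi * t :> R by apply: ler_pM => //; have := pi_ge2 R; lra.
  by rewrite mulr1.
rewrite -[leRHS]expR0 ler_expR oppr_le0; apply: divr_ge0; last by rewrite mulr_ge0 ?(ltW t0).
by rewrite /dot !addr_ge0// -expr2 sqr_ge0.
Qed.

(** On ]1, +oo[ all the terms are trivially O(t^(3/2)), as the towers have finite
   measure and the kernel is at most 1. *)
Lemma tower_heat_equation : exists C : R, forall t, 0 < t ->
  `|tower_heat t - (tower_heat (25 * t) / 25 + 6
      - 168 / 5 / Num.sqrt pi * Num.sqrt t + 72 / pi * t)| <= C * (t * Num.sqrt t).
Proof.
have [C C0 HC] := tower_heat_equation_small.
pose B : R := \sum_(f : face) fine (mu (tower e 0 1 f)) * fine (mu (tower e 0 1 f)).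
have HB t : 1 <= t -> 0 <= tower_heat t <= B.
  move=> t1; have t0 : 0 < t by apply: lt_le_trans t1.
  apply/andP; split; first by apply: sumr_ge0 => f _; exact: inter3_ge0.
  apply: ler_sum => f _; rewrite -[leRHS]mul1r.
  have fT := fin_meas_tower oe 0 f ltr01.
  apply: (interaction_le (heat3_bounded t0) fT fT) => x y _ _; exact: heat3_le1.
set b : R := 168 / 5 / Num.sqrt pi; set c : R := 72 / pi.
have b0 : 0 <= b by rewrite !divr_ge0 ?sqrtr_ge0.
have c0 : 0 <= c by rewrite divr_ge0 ?pi_ge0.
exists (C + (2 * B + 6 + b + c)) => t t0.
have B0 : 0 <= B by have /andP[] := HB 1 (lexx _); exact: le_trans.
have w0 := tsqrt_ge0 t0.
have [t1|t1] := leP t 1.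
  apply: le_trans (HC t t0 t1) _; rewrite ler_wpM2r// lerDl.
  by rewrite !addr_ge0// mulr_ge0.
have s1 : 1 <= Num.sqrt t by rewrite -sqrtr1 ler_sqrt// ltW.
have /andP[h1 h2] := HB t (ltW t1).
have /andP[h3 h4] : 0 <= tower_heat (25 * t) <= B by apply: HB; lra.
have k1 : Num.sqrt t <= t * Num.sqrt t by rewrite ler_peMl ?sqrtr_ge0// ltW.
have k2 : t <= t * Num.sqrt t by rewrite ler_peMr// ltW.
have k3 : 1 <= t * Num.sqrt t by apply: le_trans k1.
move: (tower_heat t) (tower_heat (25 * t)) (Num.sqrt t) (t * Num.sqrt t)
  h1 h2 h3 h4 s1 k1 k2 k3 w0 {HC HB}.
move=> T1 T2 s w h1 h2 h3 h4 s1 k1 k2 k3 w0.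
have Cw : 0 <= C * w by exact: mulr_ge0.
have Bw : B <= B * w by rewrite ler_peMr.
have bw : b * s <= b * w by rewrite ler_wpM2l.
have cw : c * t <= c * w by rewrite ler_wpM2l.
have bs : 0 <= b * s by rewrite mulr_ge0//; lra.
have ct : 0 <= c * t by rewrite mulr_ge0// ltW.
rewrite ler_norml !mulrDl; apply/andP; split; lra.
Qed.

Lemma expRN_lipschitz (u v : R) : 0 <= u -> 0 <= v ->
  `|expR (- u) - expR (- v)| <= `|u - v|.
Proof.
wlog uv : u v / u <= v.
  by move=> H u0 v0; have [uv|vu] := leP u v;
    [exact: H|rewrite distrC (distrC u); apply: H => //; exact: ltW].
move=> u0 v0; rewrite ger0_norm; last by rewrite subr_ge0 ler_expR lerN2.
rewrite ler0_norm ?subr_le0// opprB.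
have -> : - v = - u + (- (v - u)) by ring.
rewrite expRD.
have h1 := expR_ge1Dx (- (v - u)).
have h2 : expR (- u) <= 1 by rewrite -[leRHS]expR0 ler_expR oppr_le0.
have h3 := expR_ge0 (- u).
have h4 : expR (- (v - u)) <= 1 by rewrite -[leRHS]expR0 ler_expR oppr_le0 subr_ge0.
by move: (expR (- u)) (expR (- (v - u))) h1 h2 h3 h4 => p q *; nra.
Qed.

Lemma tower_dist f x y : tower e 0 1 f x -> tower e 0 1 f y ->
  dot (x - y) (x - y) <= 27 / 4.
Proof.
move=> /(tower_box oe ltr01)[hx _] /(tower_box oe ltr01)[hy _].
rewrite -(dot_frame_coords (x - y) (x - y) oe) /frame_coords.
have key i : dot (x - y) (e i) * dot (x - y) (e i) <= 9 / 4.
  have := hx (i, true); have := hx (i, false); have := hy (i, true); have := hy (i, false).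
  rewrite /face_coord /normal /= !subr0 !dotNr dotBl.
  by move: (dot x (e i)) (dot y (e i)) => u v *; nra.
have := key i0; have := key i1; have := key i2.
by rewrite {7}/dot /=; lra.
Qed.

Lemma continuous_sum_seq (I : Type) (r : seq I) (F : I -> R -> R) (t : R) :
  (forall i, {for t, continuous (F i)}) ->
  {for t, continuous (fun u => \sum_(i <- r) F i u)}.
Proof.
move=> cF; elim: r => [|i r IH].
  rewrite (_ : (fun u => _) = fun=> 0); first exact: cvg_cst.
  by apply/funext => u; rewrite big_nil.
rewrite (_ : (fun u => _) = F i \+ (fun u => \sum_(j <- r) F j u)); last first.
  by apply/funext => u; rewrite big_cons.
by apply: cvgD; [exact: cF|exact: IH].
Qed.

Let gauss (b : R) (z : V3 * V3) : R := expR (- (dot (z.1 - z.2) (z.1 - z.2) * b)).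

Let peak t : R := (Num.sqrt (4 * pi * t))^-1 ^+ 3.

Let peak_gt0 t : 0 < t -> 0 < peak t.
Proof. by move=> t0; rewrite exprn_gt0// invr_gt0 sqrtr_gt0 four_pi_gt0. Qed.

Let heat3_gauss t : 0 < t -> heat3 t = (fun z => peak t * gauss (4 * t)^-1 z).
Proof. by move=> t0; apply/funext => -[x y]; rewrite heat3E. Qed.

Let dot_ge0 x : 0 <= dot x x.
Proof. by rewrite /dot !addr_ge0// -expr2 sqr_ge0. Qed.

Let gauss_bounded b : 0 < b -> bounded_kernel (gauss b).
Proof.
move=> b0; have t0 : 0 < (4 * b)^-1 by rewrite invr_gt0 mulr_gt0.
have E : gauss b = (fun z => (peak (4 * b)^-1)^-1 * heat3 (4 * b)^-1 z).
  rewrite heat3_gauss//; apply/funext => z; rewrite mulKf ?gt_eqF ?peak_gt0//.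
  by rewrite invfM invrK mulrA mulVf// mul1r.
split; last first.
  exists 1 => z; rewrite expR_ge0 -[leRHS]expR0 ler_expR oppr_le0.
  by rewrite mulr_ge0 ?dot_ge0// ltW.
rewrite E; apply: measurable_funM; first exact: measurable_cst.
by case: (heat3_bounded t0).
Qed.

(** The kernel is an explicit peak times [expR (- r ^+ 2 / (4 * t))]. On a bounded
   set the exponential is Lipschitz in [1 / t], uniformly in space. *)
Lemma tower_heat_continuous t : 0 < t -> {for t, continuous tower_heat}.
Proof.
move=> t0; apply: continuous_sum_seq => f.
set A := tower e 0 1 f; have fA : fin_meas mu A by exact: fin_meas_tower.
pose G u : R := interaction mu (gauss (4 * u)^-1) A A.
have b0 (u : R) : 0 < u -> 0 < (4 * u)^-1 by move=> u0; rewrite invr_gt0 mulr_gt0.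
have GE u : 0 < u -> inter3 u A A = peak u * G u.
  move=> u0; rewrite /inter3 /G /interaction heat3_gauss// RintegralZl//.
    by apply: measurableX; case: fA.
  exact: (interaction_integrable (gauss_bounded (b0 u u0)) fA fA).
pose V : R := fine (mu A) * fine (mu A).
have V0 : 0 <= V by rewrite mulr_ge0 ?fine_ge0.
have Glip u : 0 < u -> `|G t - G u| <= 27 / 4 * `|(4 * t)^-1 - (4 * u)^-1| * V.
  move=> u0; apply: (interaction_dist (gauss_bounded (b0 t t0))
    (gauss_bounded (b0 u u0)) fA fA).
  move=> x y Ax Ay; rewrite /gauss /=.
  have d0 := dot_ge0 (x - y); have d1 := tower_dist Ax Ay.
  apply: le_trans (expRN_lipschitz _ _) _.
  - by rewrite mulr_ge0// ltW// b0.
  - by rewrite mulr_ge0// ltW// b0.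
  by rewrite -mulrBr normrM (ger0_norm d0) ler_wpM2r.
have W1 : 0 < 27 / 4 * V + 1 by apply: ltr_wpDl => //; exact: mulr_ge0.
have cinv : {for t, continuous (fun u : R => (4 * u)^-1)}.
  apply: cvgV; first by rewrite gt_eqF// mulr_gt0.
  by apply: cvgMr; exact: cvg_id.
have cG : {for t, continuous G}.
  apply/cvgrPdist_lt => eps eps0.
  have k0 : 0 < eps / (27 / 4 * V + 1) by rewrite divr_gt0.
  have /cvgrPdist_lt /(_ _ k0) near_inv := cinv.
  near=> u.
  have u0 : 0 < u by near: u; exact: lt_nbhsr.
  apply: le_lt_trans (Glip u u0) _.
  have : `|(4 * t)^-1 - (4 * u)^-1| < eps / (27 / 4 * V + 1) by near: u.
  rewrite ltr_pdivlMr//.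
  have := normr_ge0 ((4 * t)^-1 - (4 * u)^-1).
  by move: `|_| => z z0 h; apply: le_lt_trans h; nra.
have cpeak : {for t, continuous peak}.
  have c4 : {for t, continuous (fun u : R => 4 * pi * u)} by apply: cvgMr; exact: cvg_id.
  have cs : {for t, continuous (fun u : R => (Num.sqrt (4 * pi * u))^-1)}.
    apply: cvgV; first by rewrite gt_eqF// sqrtr_gt0 four_pi_gt0.
    by apply: continuous_comp; [exact: c4|exact: sqrt_continuous].
  have -> : peak = (fun u : R => (Num.sqrt (4 * pi * u))^-1 *
      ((Num.sqrt (4 * pi * u))^-1 * (Num.sqrt (4 * pi * u))^-1)).
    by apply/funext => z; rewrite /peak !exprS expr0 mulr1.
  by apply: cvgM => //; exact: cvgM.
have eqn : {near nbhs t, (fun u => peak u * G u) =1 (fun u => inter3 u A A)}.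
  near=> w; apply/esym; apply: GE; near: w; exact: lt_nbhsr.
have lim : (fun u : R => inter3 u A A) @ t --> peak t * G t.
  apply: cvg_trans; first exact: (near_eq_cvg eqn).
  by apply: cvgM; [exact: cpeak|exact: cG].
by move: lim; rewrite -(GE t t0).
Unshelve. all: by end_near.
Qed.

Lemma tower_heat_expansion : exists q : R -> R, exists C : R,
  [/\ continuous q, (forall z, q (z + ln 25) = q z) &
  forall t, 0 < t -> `|tower_heat t - (25 / 4 - 42 / Num.sqrt pi * Num.sqrt t
    - 72 / pi / ln 25 * t * ln t + q (ln t) * t)| <= C * (t * Num.sqrt t)].
Proof.
have [C HC] := tower_heat_equation.
have [q [cq pq hq]] := renewal HC tower_heat_continuous.
exists q, C; split=> // t t0; have := hq t t0.
have -> : 25 / 24 * 6 = 25 / 4 :> R by field.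
have -> : 5 / 4 * (168 / 5 / Num.sqrt pi) = 42 / Num.sqrt pi :> R.
  by move: (Num.sqrt pi)^-1 => p; field.
by [].
Qed.

End TowerHeat.

(** * The boundaries of the cubes are negligible *)

Section NullBoundary.
Variable R : realType.
Local Notation M := (measurableTypeR R).
Local Notation V3 := (M * M * M)%type.
Local Notation mu := (@mu3 R).
Local Notation s := (5^-1 : R).
Variable e : 'I_3 -> R * R * R.
Hypothesis oe : orthonormal_frame e.
Implicit Types (c x y : R * R * R) (a t p : R) (f g h : face).

Lemma continuous_dot_sub c (z : R * R * R) : continuous (fun x => dot (x - c) z).
Proof.
move=> x; rewrite /dot.
have c1 : (fun u : R * R * R => u.1.1) @ x --> x.1.1.
  by apply: (@cvg_comp _ _ _ fst fst); exact: cvg_fst.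
have c2 : (fun u : R * R * R => u.1.2) @ x --> x.1.2.
  by apply: (@cvg_comp _ _ _ fst snd); [exact: cvg_fst|exact: cvg_snd].
have c3 : (fun u : R * R * R => u.2) @ x --> x.2 by exact: cvg_snd.
apply: cvgD; first apply: cvgD; apply: cvgMl; apply: cvgB; try exact: cvg_cst.
- exact: c1.
- exact: c2.
- exact: c3.
Qed.

Lemma closed_closed_cube c a : closed (closed_cube e c a : set (R * R * R)).
Proof.
have -> : closed_cube e c a =
    \bigcap_(g in [set: face]) (face_coord e c g @^-1` [set u | u <= a / 2]).
  by apply/seteqP; split => x H g; [move=> _; exact: H|exact: H].
apply: closed_bigI => g _.
have /continuous_closedP cc := @continuous_dot_sub c (normal e g).
exact: (cc _ (closed_le (y := _))).
Qed.

Lemma open_open_cube c a : open (open_cube e c a).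
Proof.
have oi i : open [set x | `|dot (x - c) (e i)| < a / 2].
  rewrite (_ : [set x | _] = (fun x => dot (x - c) (e i)) @^-1` [set u | `|u| < a / 2])//.
  apply: open_comp; first by move=> x _; exact: continuous_dot_sub.
  rewrite (_ : [set u | _] = [set u | - (a / 2) < u] `&` [set u | u < a / 2]).
    by apply: openI; [exact: open_gt|exact: open_lt].
  apply/seteqP; split => u /=; first by rewrite ltr_norml => /andP[].
  by move=> [u1 u2]; rewrite ltr_norml u1 u2.
have -> : open_cube e c a = [set x | `|dot (x - c) (e i0)| < a / 2] `&`
   [set x | `|dot (x - c) (e i1)| < a / 2] `&` [set x | `|dot (x - c) (e i2)| < a / 2].
  apply/seteqP; split => x; first by move=> H; split; [split|]; exact: H.
  by move=> [[h0 h1] h2]; exact: ord3P.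
by do 2?apply: openI.
Qed.

Lemma open_attached_cube c a w : open (attached_cube e s c a w).
Proof. by elim: w c a => [|g w IH] c a /=; [exact: open_open_cube|exact: IH]. Qed.

(** A closed set that contains a tower: its first n generations with their
   boundaries, and the bounding boxes of the towers that remain. *)
Fixpoint cover (n : nat) c a f : set V3 :=
  if n is n'.+1 then closed_cube e c a `|`
    \big[setU/set0]_(g | may_follow f g) cover n' (child e c a g) (s * a) g
  else closed_cube e c (3 / 2 * a).

Lemma closed_cover n c a f : closed (cover n c a f : set (R * R * R)).
Proof.
elim: n c a f => [|n IH] c a f /=; first exact: closed_closed_cube.
apply: closedU; first exact: closed_closed_cube.
by apply: big_ind => //; [exact: closed0|exact: closedU].
Qed.

Lemma tower_sub_cover n c a f : 0 < a -> tower e c a f `<=` cover n c a f.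
Proof.
elim: n c a f => [|n IH] c a f a0 /=; first exact: tower_sub_closed_cube.
rewrite towerE bigcup_big; apply: setUSS; first exact: open_cube_closed.
rewrite -!bigcup_big; apply: subset_bigcup => g _; apply: IH.
by rewrite mulr_gt0.
Qed.

Lemma measurable_cover n c a f : measurable (cover n c a f).
Proof.
elim: n c a f => [|n IH] c a f /=; first exact: measurable_closed_cube.
apply: measurableU; first exact: measurable_closed_cube.
by apply: big_ind => [|A B|g _]; [exact: measurable0|exact: measurableU|exact: IH].
Qed.

Lemma mu_bigU_le (P : pred face) (F : face -> set V3) (k : R) : 0 <= k ->
  (forall g, P g -> measurable (F g)) -> (forall g, P g -> (mu (F g) <= k%:E)%E) ->
  (mu (\big[setU/set0]_(g | P g) F g) <= (6 * k)%:E)%E.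
Proof.
move=> k0 mF Fk.
have H : measurable (\big[setU/set0]_(g | P g) F g) /\
    (mu (\big[setU/set0]_(g | P g) F g) <= (\sum_(g | P g) k)%:E)%E.
  apply: (big_ind2 (fun A (r : R) => measurable A /\ (mu A <= r%:E)%E)).
  - by split; [exact: measurable0|rewrite measure0].
  - move=> A u B v [mA hA] [mB hB]; split; first exact: measurableU.
    by apply: le_trans (measureU2 _ mA mB) _; rewrite EFinD leeD.
  - by move=> g Pg; split; [exact: mF|exact: Fk].
apply: le_trans H.2 _; rewrite lee_fin -(sum_face_const k).
by rewrite [leRHS](bigID P)/= lerDl sumr_ge0.
Qed.

(** The boundary of a single cube is null, so the excess of the cover over the set
   comes from the at most six towers it carries. *)
Lemma mu_layer_diff n c a (P : pred face) (k : R) : 0 <= a -> 0 <= k ->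
  (forall g, P g ->
    (mu (cover n (child e c a g) (s * a) g
         `\` tower e (child e c a g) (s * a) g) <= k%:E)%E) ->
  (mu ((closed_cube e c a
        `|` \big[setU/set0]_(g | P g) cover n (child e c a g) (s * a) g)
       `\` (open_cube e c a
        `|` \big[setU/set0]_(g | P g) tower e (child e c a g) (s * a) g))
   <= (6 * k)%:E)%E.
Proof.
move=> a0 k0 Pk.
pose F g := cover n (child e c a g) (s * a) g.
pose G g := tower e (child e c a g) (s * a) g.
pose A := closed_cube e c a `\` open_cube e c a.
pose B g := F g `\` G g.
have mA : measurable A.
  by apply: measurableD; [exact: measurable_closed_cube|exact: measurable_open_cube].
have mB g : measurable (B g).
  by apply: measurableD; [exact: measurable_cover|exact: measurable_tower].
have mBU : measurable (\big[setU/set0]_(g | P g) B g).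
  by apply: big_ind => [|X Y|g _]; [exact: measurable0|exact: measurableU|exact: mB].
have mFU : measurable (\big[setU/set0]_(g | P g) F g).
  apply: big_ind => [|X Y|g _]; [exact: measurable0|exact: measurableU|].
  exact: measurable_cover.
have mGU : measurable (\big[setU/set0]_(g | P g) G g).
  apply: big_ind => [|X Y|g _]; [exact: measurable0|exact: measurableU|].
  exact: measurable_tower.
have mC := @measurable_closed_cube _ e c a.
have mO := @measurable_open_cube _ e c a.
apply: (@le_trans _ _ (mu (A `|` \big[setU/set0]_(g | P g) B g))).
  apply: le_measure; rewrite ?inE.
  - by apply: measurableD; exact: measurableU.
  - exact: measurableU.
  - rewrite -!bigcup_big => x [[xC|[g Pg xg]] nT].
      by left; split=> // xQ; apply: nT; left.
    by right; exists g => //; split=> // xT; apply: nT; right; exists g.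
have A0 : mu A = 0%E := closed_cube_boundary_null oe c a0.
apply: (@le_trans _ _ (mu A + mu (\big[setU/set0]_(g | P g) B g))%E).
  exact: measureU2.
rewrite A0 add0e; apply: mu_bigU_le => // g Pg; exact: Pk.
Qed.

(** The initial constant is the volume of the bounding box, [(3 / 2) ^+ 3]. At each
   generation the number of pieces grows by at most 6 while volumes shrink by
   125, and 6 / 125 is less than 1 / 5. *)
Lemma mu_cover_diff n c a f : 0 < a ->
  (mu (cover n c a f `\` tower e c a f) <= (27 / 8 * a ^+ 3 * 5 ^- n)%:E)%E.
Proof.
elim: n c a f => [|n IH] c a f a0 /=.
  rewrite expr0 invr1 mulr1; apply: (@le_trans _ _ (mu (closed_cube e c (3 / 2 * a)))).
    apply: le_measure; rewrite ?inE//.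
    - by apply: measurableD; [exact: measurable_closed_cube|exact: measurable_tower].
    - exact: measurable_closed_cube.
  have a1 : 0 <= 3 / 2 * a by lra.
  rewrite (mu3_closed_cube oe c a1) lee_fin le_eqVlt; apply/orP; left; apply/eqP.
  by field.
have sa0 : 0 < s * a by rewrite mulr_gt0.
have k0 : 0 <= 27 / 8 * (s * a) ^+ 3 * 5 ^- n.
  by rewrite !mulr_ge0 ?invr_ge0 ?exprn_ge0// ltW.
rewrite towerE bigcup_big.
apply: le_trans (mu_layer_diff (ltW a0) k0 (fun g _ => IH _ _ g sa0)) _.
rewrite lee_fin.
have -> : 5 ^- n.+1 = 5^-1 * 5 ^- n :> R by rewrite exprS invfM.
have z0 : 0 <= 27 / 8 * a ^+ 3 * 5 ^- n.
  by rewrite !mulr_ge0 ?invr_ge0 ?exprn_ge0// ltW.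
have -> : 6 * (27 / 8 * (s * a) ^+ 3 * 5 ^- n) =
    6 / 125 * (27 / 8 * a ^+ 3 * 5 ^- n).
  by move: (5 ^- n) => z; field.
have -> : 27 / 8 * a ^+ 3 * (s * 5 ^- n) = 1 / 5 * (27 / 8 * a ^+ 3 * 5 ^- n).
  by move: (5 ^- n) => z; field.
by move: (_ * 5 ^- n) z0 => z z0; lra.
Qed.

(** The interior of the closure of the union U of the open cubes lies between U and
   each of the closed covers of U, whose measures tend to that of U. *)
Lemma fractal_polyhedron_ae c :
  [/\ cube_with_branches e c xpredT `<=` fractal_polyhedron e c s,
      fin_meas mu (fractal_polyhedron e c s) &
      mu (fractal_polyhedron e c s `\` cube_with_branches e c xpredT) = 0%E].
Proof.
set D := fractal_polyhedron e c s; set U := cube_with_branches e c xpredT.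
have oU : open (U : set (R * R * R)).
  rewrite /U -attached_cubes_branches; apply: bigcup_open => w _.
  exact: open_attached_cube.
have UD : U `<=` D.
  rewrite /D /fractal_polyhedron attached_cubes_branches -/U.
  by apply: subset_trans (interiorS (@subset_closure _ U)); rewrite -open_subsetE.
have mD : measurable D by apply: open_measurable3; exact: open_interior.
have mU : measurable U by apply: open_measurable3.
pose C n : set V3 := closed_cube e c 1 `|` \big[setU/set0]_g cover n (child e c 1 g) (s * 1) g.
have s0 : 0 < s * 1 :> R by exact: s1_gt0.
have DC n : D `<=` C n.
  apply: (subset_trans (@interior_subset _ _)).
  have cC : closed (C n : set (R * R * R)).
    apply: closedU; first exact: closed_closed_cube.
    by apply: big_ind => [|A B|g _]; [exact: closed0|exact: closedU|exact: closed_cover].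
  rewrite attached_cubes_branches -/U ((closure_id (C n)).1 cC).
  apply: closureS; apply: setUSS; first exact: open_cube_closed.
  rewrite -!(bigcup_big xpredT); apply: subset_bigcup => g _.
  exact: tower_sub_cover.
have mC n : measurable (C n).
  apply: measurableU; first exact: measurable_closed_cube.
  apply: big_ind => [|A B|g _]; [exact: measurable0|exact: measurableU|].
  exact: measurable_cover.
have bound n : (mu (D `\` U) <= (6 * (27 / 8 * (s * 1) ^+ 3 * 5 ^- n))%:E)%E.
  have k0 : 0 <= 27 / 8 * (s * 1) ^+ 3 * 5 ^- n.
    by rewrite !mulr_ge0 ?invr_ge0 ?exprn_ge0// ltW.
  apply: le_trans (mu_layer_diff ler01 k0 (fun g (_ : true) => mu_cover_diff n _ g s0)).
  rewrite -/(C n) -/(cube_with_branches e c xpredT) -/U.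
  apply: le_measure; rewrite ?inE; [exact: measurableD| |exact: setSD (DC n)].
  exact: measurableD (mC n) mU.
have fU : fin_meas mu U.
  apply: fin_measU; first exact: fin_meas_open_cube.
  by apply: fin_meas_bigU => g; exact: fin_meas_branch.
have fD : mu (D `\` U) \is a fin_num.
  by rewrite ge0_fin_numE//; apply: le_lt_trans (bound 0%N) _; exact: ltry.
have D0 : mu (D `\` U) = 0%E.
  rewrite -(fineK fD); congr EFin; apply/eqP; rewrite eq_le fine_ge0// andbT.
  apply: (@le0_pow5 _ _ (6 * (27 / 8 * (s * 1) ^+ 3))) => n.
  have := bound n; rewrite -[X in (X <= _)%E -> _](fineK fD) lee_fin => h.
  by apply: le_trans h _; rewrite !mulrA lexx.
split=> //; split=> //.
rewrite -(setDUK UD); apply: (@le_lt_trans _ _ (mu U + mu (D `\` U))%E).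
  by apply: measureU2 => //; exact: measurableD.
by rewrite D0 adde0; case: fU.
Qed.

End NullBoundary.

(** * The heat content of the fractal polyhedron *)

Section HeatContentExpansion.
Variable R : realType.
Local Notation S t := (Num.sqrt (t / pi)).
Variable e : 'I_3 -> R * R * R.
Hypothesis oe : orthonormal_frame e.

Lemma heat_content_branches c t : 0 < t ->
  heat_content (fractal_polyhedron e c 5^-1) t =
  inter3 t (cube_with_branches e c xpredT) (cube_with_branches e c xpredT).
Proof.
move=> t0; have [UD fD D0] := fractal_polyhedron_ae oe c.
have mU : fin_meas (@mu3 R) (cube_with_branches e c xpredT).
  apply: fin_measU; first exact: fin_meas_open_cube.
  by apply: fin_meas_bigU => g; exact: fin_meas_branch.
have gK := heat3_bounded t0.
rewrite (heat_content_inter3 t0 fD.1) /inter3.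
rewrite (interaction_ae gK mU fD fD UD D0).
rewrite -!/(inter3 t _ _) (inter3_sym t0 mU.1 fD.1) /inter3.
exact: (interaction_ae gK mU fD mU UD D0).
Qed.

(** [cube_with_branches_expansion] with all six branches, whose contribution is
   [12 / 25 * S t + tower_heat (25 * t) / 125]. The coefficients are
   21/20 = 1 + (25/4)/125 and - 36/5 = - 6 + 12/25 - 5 * 42/125; the term in
   [t * ln t] contributes to that in [t] through [ln (25 * t)]. *)
Lemma heat_content_expansion c : exists q : R -> R, exists C : R,
  [/\ continuous q, (forall z, q (z + ln 25) = q z), 0 <= C &
  forall t, 0 < t -> t <= 1 ->
    `|heat_content (fractal_polyhedron e c 5^-1) t -
      (21 / 20 - 36 / 5 / Num.sqrt pi * Num.sqrt t
       + (12 / pi - 72 / (5 * pi)) * t - 72 / (5 * pi) / ln 25 * t * ln t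
       + q (ln t) / 5 * t)| <= C * (t * Num.sqrt t)].
Proof.
have [C1 C10 H1] := cube_with_branches_expansion oe c xpredT.
have [q [C2 [cq pq H2]]] := tower_heat_expansion oe.
have ln25 : ln 25 != 0 :> R by rewrite gt_eqF// ln_gt0// ltr1n.
have pi0 : pi != 0 :> R by rewrite gt_eqF// pi_gt0.
exists q, (C1 + `|C2|); split=> //; first by rewrite addr_ge0.
move=> t t0 t1; have t25 : 0 < 25 * t by rewrite mulr_gt0.
rewrite (heat_content_branches c t0).
have h1 := H1 t t0 t1; have := H2 _ t25; move: h1.
have -> : Num.sqrt (25 * t) = 5 * Num.sqrt t.
  by rewrite sqrtrM// (_ : 25 = 5 ^+ 2 :> R) ?sqrtr_sqr ?ger0_norm//; ring.
have -> : ln (25 * t) = ln t + ln 25 by rewrite addrC lnM ?posrE.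
rewrite pq.
have -> : \sum_(g : face) (2 / 25 * S t +
    inter3 (25 * t) (tower e 0 1 g) (tower e 0 1 g) / 125) =
    12 / 25 * S t + tower_heat e (25 * t) / 125.
  rewrite big_split/= sum_face_const -mulr_suml /tower_heat; congr (_ + _).
  by move: (S t) => z; field.
rewrite sqrt_div_pi//; have st0 := sqrtr_ge0 t.
set X := inter3 _ _ _; move: X (tower_heat _ _) (ln t) (q _) => X T L Q.
move: ln25; move: (ln 25) => l l0.
move: (Num.sqrt t) st0 => r r0; move: (Num.sqrt pi)^-1 => k.
move: (pi : R) pi0 => p p0 {H1 H2}.
have tr0 : 0 <= t * r by rewrite mulr_ge0// ltW.
set A := _ - (_ + (_ * (r * k) + _)); set B := T - _ => hA hB.
rewrite (_ : _ - _ = A + B / 125); last by rewrite /A /B; field; rewrite p0 l0.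
move: A B hA hB => A B hA hB; rewrite mulrDl.
apply: le_trans (ler_normD _ _) (lerD hA _).
rewrite normrM [`|125^-1|]ger0_norm ?invr_ge0//.
have h : C2 * (t * r) <= `|C2| * (t * r) by rewrite ler_wpM2r// ler_norm.
rewrite ler_pdivrMr// mulrC; apply: le_trans hB _.
by rewrite (_ : C2 * _ = 125 * (C2 * (t * r))) ?ler_wpM2l//; ring.
Qed.

End HeatContentExpansion.

Theorem theorem3 (R : realType) (e : 'I_3 -> R * R * R) (c : R * R * R) :
  orthonormal_frame e ->
  exists p : R -> R,
    [/\ continuous p, periodic p (ln 25) &
      heat_content (fractal_polyhedron e c 5^-1) =
        (fun t : R => 21 / 20
           - 36 / 5 * (t `^ (1 / 2) / Num.sqrt pi)
           + 132 / (5 * pi) * t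
           - 36 / (5 * pi * ln 5) * t * ln t
           + 6 * p (ln t) * t)
        +O_ (0^'+) (fun t : R => t `^ (3 / 2) * ln t^-1 `^ (3 / 2))].
Proof.
move=> oe; have [q [C [cq pq C0 H]]] := heat_content_expansion oe c.
(* So that 6 p = q / 5 - 144 / (5 pi), which makes up for the difference
   between 12 / pi - 72 / (5 pi) and 132 / (5 pi). *)
exists (fun y => q y / 30 - 24 / (5 * pi)); split.
- move=> y; apply: cvgB; last exact: cvg_cst.
  by apply: cvgM; [exact: cq|exact: cvg_cst].
- by move=> y; rewrite pq.
apply/eqaddOP; near=> k; near=> t.
have t0 : 0 < t by near: t; exact: nbhs_right_gt.
(* This makes the logarithmic factor of the error at least 1. *)
have te : t < expR (-1) by near: t; apply: nbhs_right_lt; exact: expR_gt0.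
have t1 : t <= 1.
  by apply: le_trans (ltW te) _; rewrite -[leRHS]expR0 ler_expR lerN10.
have -> : t `^ (3 / 2) = t * Num.sqrt t.
  have -> : 3 / 2 = 1 + 2^-1 :> R by field.
  by rewrite powRD ?(gt_eqF t0) ?implybT// powRr1 ?ltW// powR12_sqrt ?ltW.
have r0 : 0 <= t * Num.sqrt t by rewrite mulr_ge0 ?sqrtr_ge0// ltW.
have Ck : C <= k by near: k; apply: nbhs_pinfty_ge; exact: num_real.
have L1 : 1 <= ln t^-1 `^ (3 / 2).
  suff : 1 `^ (3 / 2) <= ln t^-1 `^ (3 / 2) by rewrite powR1.
  apply: ge0_ler_powR; rewrite ?nnegrE//.
  - by rewrite ln_ge0// invf_ge1.
  - rewrite lnV ?posrE// lerNr -[leRHS]expRK ler_ln ?posrE ?expR_gt0//.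
    exact: ltW.
rewrite normrM (ger0_norm r0) (ger0_norm (le_trans ler01 L1)).
apply: (@le_trans _ _ (C * (t * Num.sqrt t))); last first.
  rewrite [leRHS]mulrA -[leLHS]mulr1; apply: ler_pM => //; first exact: mulr_ge0.
  exact: ler_wpM2r.
apply: le_trans (H t t0 t1); rewrite le_eqVlt; apply/orP; left; apply/eqP.
congr (`|_|); congr (_ - _).
have -> : t `^ (1 / 2) = Num.sqrt t by rewrite mul1r powR12_sqrt ?ltW.
have -> : ln 25 = 2 * ln 5 :> R.
  by rewrite (_ : 25 = 5 ^+ 2 :> R) ?lnXn// ?mulr_natl//; ring.
have p0 : pi != 0 :> R by rewrite gt_eqF// pi_gt0.
have l0 : ln 5 != 0 :> R by rewrite gt_eqF// ln_gt0// ltr1n.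
move: (pi : R) p0 (Num.sqrt pi)^-1 (ln 5) l0 (Num.sqrt t) (ln t) (q _).
by move=> p p0 u l l0 r L Q; field; rewrite p0 l0.
Unshelve. all: by end_near.
Qed.
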